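(* Let $K$ be a metric octahedral complex, with edge lengths $a,b,c,d,e,f,g,h,p,q,r,s$, that is isometrically realizable in $\mathbb{R}^3$ as a nontrivially flexible octahedron. If at least two equators of $K$ belong to class $\mathrm{III}$, then either all equators of $K$ are metrically symmetric, or the following assertions hold: 1) the third equator also belongs to class $\mathrm{III}$; 2) $qge=pfd$, $\ bhq=cdr$, $\ rga=sfb$, $\ ahp=ces$; 3) all equators have zero sum; 4) $B_{1,1,1}\cdot B_{1,-1,-1}\cdot B_{-1,1,-1}\cdot B_{-1,-1,1}=0$, where $$\begin{aligned}B_{\varepsilon_1,\varepsilon_2,\varepsilon_3}={}&abc(h^2+s^2+r^2)-hsr(a^2+b^2+c^2)\\&+\varepsilon_1\bigl(csb(h^2+r^2-s^2)-hra(b^2+c^2-a^2)\bigr)\\&+\varepsilon_2\bigl(ahb(s^2+r^2-h^2)-src(a^2+b^2-c^2)\bigr)\\&+\varepsilon_3\bigl(cra(s^2+h^2-r^2)-shb(a^2+c^2-b^2)\bigr).\end{aligned}$$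
   Context: Octahedral complex: $K$ is the simplicial complex combinatorially equivalent to the regular octahedron, with vertices $v_1,\dots,v_6$, every two vertices being joined by an edge except the pairs $\{v_1,v_6\}$, $\{v_2,v_4\}$, $\{v_3,v_5\}$, and with the eight triangular faces $v_1v_2v_3$, $v_1v_3v_4$, $v_1v_4v_5$, $v_1v_5v_2$, $v_6v_2v_3$, $v_6v_3v_4$, $v_6v_4v_5$, $v_6v_5v_2$. Edge lengths: $p=|v_1v_2|$, $q=|v_1v_3|$, $r=|v_1v_4|$, $s=|v_1v_5|$, $c=|v_2v_3|$, $f=|v_3v_4|$, $h=|v_4v_5|$, $g=|v_5v_2|$, $b=|v_6v_2|$, $a=|v_6v_3|$, $e=|v_6v_4|$, $d=|v_6v_5|$; they are strictly positive and satisfy the strict triangle inequalities on every face. The three diagonals are $v_2v_4$, $v_3v_5$, $v_1v_6$. Flexibility: an isometric realization of $K$ in $\mathbb{R}^3$ is an assignment of points to the vertices such that the endpoints of every edge are at distance equal to the length of that edge. A nontrivial flex is a continuous family $P_t$ ($t$ in a nondegenerate interval) of isometric realizations along which all three diagonals change with $t$ (no diagonal length is constant on any nondegenerate subinterval). $K$ is realizable as a nontrivially flexible octahedron if it admits a nontrivial flex. Equators: the three equators are the 4-cycles of edges $v_2v_3v_4v_5$ (lengths $c,f,h,g$), $v_6v_2v_1v_4$ (lengths $b,p,r,e$), $v_5v_1v_3v_6$ (lengths $s,q,a,d$). An equator with edge lengths $\ell_1,\ell_2,\ell_3,\ell_4$ is metrically symmetric if ($\ell_1=\ell_3$ and $\ell_2=\ell_4$)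 or ($\ell_1=\ell_2$ and $\ell_3=\ell_4$) or ($\ell_1=\ell_4$ and $\ell_2=\ell_3$). It has zero sum if $(\ell_1+\ell_2-\ell_3-\ell_4)(\ell_1-\ell_2+\ell_3-\ell_4)(\ell_1-\ell_2-\ell_3+\ell_4)=0$. Class III: the star $K_j$ of a vertex $v_j$ is called a tetrahedral angle; its boundary is an equator $w_1w_2w_3w_4$ (cyclic order). Let $\alpha_i\in(0,\pi)$ be the plane angle $\angle w_iv_jw_{i+1}$ (indices mod 4) of the corresponding face, determined by the edge lengths. $K_j$ is of class III iff ($\alpha_1=\alpha_3$ and $\alpha_2=\alpha_4$) or ($\alpha_1=\pi-\alpha_3$ and $\alpha_2=\pi-\alpha_4$). Each equator bounds exactly two tetrahedral angles; the equator belongs to class III if both of these tetrahedral angles do. *)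

(* Defs.v *)
From Stdlib Require Import Reals List.
From Coquelicot Require Import Coquelicot.
Import ListNotations.
Open Scope R_scope.

(** * The octahedral complex *)

Inductive vertex : Set := v1 | v2 | v3 | v4 | v5 | v6.

Definition opposite (u : vertex) : vertex :=
  match u with
  | v1 => v6 | v6 => v1
  | v2 => v4 | v4 => v2
  | v3 => v5 | v5 => v3
  end.

Definition edge (u w : vertex) : Prop := u <> w /\ opposite u <> w.

Definition faces : list (vertex * vertex * vertex) :=
  [ (v1, v2, v3); (v1, v3, v4); (v1, v4, v5); (v1, v5, v2);
    (v6, v2, v3); (v6, v3, v4); (v6, v4, v5); (v6, v5, v2) ].

(** The metric is a function [l] giving the length [l u w] of each edge [uw];
    its values on pairs of vertices not joined by an edge are irrelevant. *)
Record metric_complex (l : vertex -> vertex -> R) : Prop := {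
  length_sym : forall u w, edge u w -> l u w = l w u;
  length_pos : forall u w, edge u w -> 0 < l u w;
  strict_triangle : forall u v w, In (u, v, w) faces ->
    l u v < l v w + l w u /\ l v w < l w u + l u v /\ l w u < l u v + l v w
}.

(** * Realizations and flexes *)

Definition point : Type := (R * R * R)%type.

Definition distance (x y : point) : R :=
  let '(x1, x2, x3) := x in
  let '(y1, y2, y3) := y in
  sqrt ((x1 - y1) ^ 2 + (x2 - y2) ^ 2 + (x3 - y3) ^ 2).

Definition isometric_realization (l : vertex -> vertex -> R)
    (P : vertex -> point) : Prop :=
  forall u w, edge u w -> distance (P u) (P w) = l u w.

(** Nondegenerate intervals of the line are the convex sets with at least two
    points; they may be open or closed, bounded or not. *)
Definition nondegenerate_interval (I : R -> Prop) : Prop :=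
  (forall x y t, I x -> I y -> x <= t <= y -> I t) /\
  (exists x y, I x /\ I y /\ x < y).

(** Every nondegenerate subinterval of [I] contains some [[x, y]] with
    [x < y], so the last clause needs only to consider compact ones. *)
Definition nontrivial_flex (l : vertex -> vertex -> R)
    (I : R -> Prop) (P : R -> vertex -> point) : Prop :=
  (forall v, continuous_on I (fun t => P t v)) /\
  (forall t, I t -> isometric_realization l (P t)) /\
  (forall u x y, I x -> I y -> x < y ->
     ~ exists k, forall t, x <= t <= y ->
         distance (P t u) (P t (opposite u)) = k).

Definition realizable_as_nontrivially_flexible
    (l : vertex -> vertex -> R) : Prop :=
  exists (I : R -> Prop) (P : R -> vertex -> point),
    nondegenerate_interval I /\ nontrivial_flex l I P.

(** * Equators *)

Inductive equator : Set := E2345 | E6214 | E5136.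

Definition cycle (E : equator) : vertex * vertex * vertex * vertex :=
  match E with
  | E2345 => (v2, v3, v4, v5)
  | E6214 => (v6, v2, v1, v4)
  | E5136 => (v5, v1, v3, v6)
  end.

(** The two vertices whose stars are bounded by the equator. *)
Definition poles (E : equator) : vertex * vertex :=
  match E with
  | E2345 => (v1, v6)
  | E6214 => (v3, v5)
  | E5136 => (v2, v4)
  end.

Definition metrically_symmetric (l : vertex -> vertex -> R) (E : equator)
    : Prop :=
  let '(w1, w2, w3, w4) := cycle E in
  let l1 := l w1 w2 in let l2 := l w2 w3 in
  let l3 := l w3 w4 in let l4 := l w4 w1 in
  (l1 = l3 /\ l2 = l4) \/ (l1 = l2 /\ l3 = l4) \/ (l1 = l4 /\ l2 = l3).

Definition zero_sum (l : vertex -> vertex -> R) (E : equator) : Prop :=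
  let '(w1, w2, w3, w4) := cycle E in
  let l1 := l w1 w2 in let l2 := l w2 w3 in
  let l3 := l w3 w4 in let l4 := l w4 w1 in
  (l1 + l2 - l3 - l4) * (l1 - l2 + l3 - l4) * (l1 - l2 - l3 + l4) = 0.

(** * Class III *)

(** The angle at [v] of the triangle [u v w], by the law of cosines.  Under the
    strict triangle inequalities the argument of [acos] lies in (-1, 1). *)
Definition plane_angle (l : vertex -> vertex -> R) (u v w : vertex) : R :=
  acos ((l v u ^ 2 + l v w ^ 2 - l u w ^ 2) / (2 * l v u * l v w)).

Definition angle_class_III (l : vertex -> vertex -> R) (v : vertex)
    (C : vertex * vertex * vertex * vertex) : Prop :=
  let '(w1, w2, w3, w4) := C in
  let alpha1 := plane_angle l w1 v w2 in
  let alpha2 := plane_angle l w2 v w3 in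
  let alpha3 := plane_angle l w3 v w4 in
  let alpha4 := plane_angle l w4 v w1 in
  (alpha1 = alpha3 /\ alpha2 = alpha4) \/
  (alpha1 = PI - alpha3 /\ alpha2 = PI - alpha4).

Definition class_III (l : vertex -> vertex -> R) (E : equator) : Prop :=
  angle_class_III l (fst (poles E)) (cycle E) /\
  angle_class_III l (snd (poles E)) (cycle E).

Definition B (a b c h r s eps1 eps2 eps3 : R) : R :=
  a * b * c * (h ^ 2 + s ^ 2 + r ^ 2) - h * s * r * (a ^ 2 + b ^ 2 + c ^ 2)
  + eps1 * (c * s * b * (h ^ 2 + r ^ 2 - s ^ 2)
            - h * r * a * (b ^ 2 + c ^ 2 - a ^ 2))
  + eps2 * (a * h * b * (s ^ 2 + r ^ 2 - h ^ 2)
            - s * r * c * (a ^ 2 + b ^ 2 - c ^ 2))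
  + eps3 * (c * r * a * (s ^ 2 + h ^ 2 - r ^ 2)
            - s * h * b * (a ^ 2 + c ^ 2 - b ^ 2)).

(* Main.v *)
Require Import Defs.
From Stdlib Require Import Reals List.
From Coquelicot Require Import Coquelicot.
From Stdlib Require Import Lra Classical.
Open Scope R_scope.

(** The five points of the star of a vertex satisfy a Gram determinant relation
    between the squares of two diagonals.  For a star of class III, where the
    opposite plane angles have cosines [C] and [eps * C], it splits into two
    hyperbolas [(X - x0) (Y - y0) = k], whose centres are squares of sums or
    differences of edges at the vertex, and [eps * k > 0].  Along a flex one of
    the two holds on a subinterval.  Two stars with the same boundary equator give
    the same hyperbola, which yields zero sums.  Two such hyperbolas sharing a
    diagonal force a third one between the two remaining diagonals, hence a
    factorization of its Gram determinant, hence class III for the third equator.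
    The three constants then have negative product, so the signs [eps] of the
    equators have product [-1]; they are not all [-1], because the sum of the
    cosines of the angles of a triangle is positive.  So exactly one equator has
    [eps = -1], and up to a rotation of order 3 it is [v2 v3 v4 v5].  The four
    product relations follow from the equality of the sines of opposite angles at
    the vertices; eliminating [p, q, d, e] from them, from the zero sums and from
    the angle conditions at [v1] and [v6] gives [B = 0] up to factors whose
    vanishing makes every equator metrically symmetric. *)

(** * Edge lengths when the angles at v1 and v6 are supplementary *)

Definition is_sign (e : R) : Prop := e = 1 \/ e = -1.

Definition symmetric4 (l1 l2 l3 l4 : R) : Prop :=
  (l1 = l3 /\ l2 = l4) \/ (l1 = l2 /\ l3 = l4) \/ (l1 = l4 /\ l2 = l3).

Definition zero_sum4 (l1 l2 l3 l4 : R) : Prop :=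
  (l1 + l2 - l3 - l4) * (l1 - l2 + l3 - l4) * (l1 - l2 - l3 + l4) = 0.

Lemma Rmult_cancel_l (k x y : R) : k <> 0 -> k * x = k * y -> x = y.
Proof. intros Hk E; exact (Rmult_eq_reg_l k x y E Hk). Qed.

Lemma sign_of_sqr_eq (x y : R) : x ^ 2 = y ^ 2 -> exists e, is_sign e /\ x = e * y.
Proof.
  intros E.
  assert (E' : (x - y) * (x + y) = 0) by (ring_simplify; lra).
  destruct (Rmult_integral _ _ E') as [H | H].
  - exists 1; split; [left; reflexivity | lra].
  - exists (-1); split; [right; reflexivity | lra].
Qed.

(** Each zero-sum factor expresses [l4] linearly; the equality of products then splits into factors
    that are differences of sides or positive sums. *)
Lemma symmetric4_of_equal_ratios (l1 l2 l3 l4 : R) :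
  0 < l1 -> 0 < l2 -> 0 < l3 -> 0 < l4 ->
  l1 * l4 = l2 * l3 \/ l1 * l2 = l3 * l4 -> zero_sum4 l1 l2 l3 l4 ->
  symmetric4 l1 l2 l3 l4.
Proof.
  intros p1 p2 p3 p4 Hr Hz; unfold zero_sum4, symmetric4 in *.
  destruct (Rmult_integral _ _ Hz) as [Hz' | Hz'];
    [destruct (Rmult_integral _ _ Hz') as [Hz'' | Hz''] |].
  - assert (l4 = l1 + l2 - l3) by lra; subst l4.
    assert (F : (l1 - l3) * (l1 + l2) = 0 \/ (l1 - l3) * (l2 - l3) = 0)
      by (destruct Hr; [left | right]; lra).
    destruct F as [F | F]; destruct (Rmult_integral _ _ F); lra.
  - assert (l4 = l1 - l2 + l3) by lra; subst l4.
    assert (F : (l1 - l2) * (l1 + l3) = 0 \/ (l1 + l3) * (l2 - l3) = 0)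
      by (destruct Hr; [left | right]; lra).
    destruct F as [F | F]; destruct (Rmult_integral _ _ F); lra.
  - assert (l4 = l2 + l3 - l1) by lra; subst l4.
    assert (F : (l1 - l3) * (l1 - l2) = 0 \/ (l1 - l3) * (l2 + l3) = 0)
      by (destruct Hr; [left | right]; lra).
    destruct F as [F | F]; destruct (Rmult_integral _ _ F); lra.
Qed.

Definition all_symmetric (a b c d e f g h p q r s : R) : Prop :=
  symmetric4 c f h g /\ symmetric4 b p r e /\ symmetric4 s q a d.

(** Equal opposite sides in one equator turn the product relations into a proportion between the
    sides of each other equator. *)
Lemma all_symmetric_of_opposite_equal (a b c d e f g h p q r s : R) :
  0 < a -> 0 < b -> 0 < c -> 0 < d -> 0 < e -> 0 < f ->
  0 < g -> 0 < h -> 0 < p -> 0 < q -> 0 < r -> 0 < s ->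
  q * g * e = p * f * d -> b * h * q = c * d * r ->
  r * g * a = s * f * b -> a * h * p = c * e * s ->
  zero_sum4 c f h g -> zero_sum4 b p r e -> zero_sum4 s q a d ->
  (c = h /\ f = g) \/ (b = r /\ p = e) \/ (s = a /\ q = d) ->
  all_symmetric a b c d e f g h p q r s.
Proof.
  intros pa pb pc pd pe pf pg ph pp pq pr ps R1 R2 R3 R4 Z1 Z2 Z3 H.
  unfold all_symmetric.
  destruct H as [[<- <-] | [[<- <-] | [<- <-]]].
  - split; [left; lra |]; split; apply symmetric4_of_equal_ratios; auto.
    + right. apply (Rmult_cancel_l (c * d * f)); [apply Rgt_not_eq; repeat apply Rmult_lt_0_compat; auto |].
      transitivity ((p * f * d) * b * c); [ring |].
      rewrite <- R1. transitivity ((b * c * q) * f * e); [ring |].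
      rewrite R2; ring.
    + left. apply (Rmult_cancel_l (b * c * f)); [apply Rgt_not_eq; repeat apply Rmult_lt_0_compat; auto |].
      transitivity ((s * f * b) * c * d); [ring |].
      rewrite <- R3. transitivity ((c * d * r) * f * a); [ring |].
      rewrite <- R2; ring.
  - split; [| split; [left; lra |]]; apply symmetric4_of_equal_ratios; auto.
    + left. apply (Rmult_cancel_l (b * s * p)); [apply Rgt_not_eq; repeat apply Rmult_lt_0_compat; auto |].
      transitivity ((c * p * s) * g * b); [ring |].
      rewrite <- R4. transitivity ((b * g * a) * h * p); [ring |].
      rewrite R3; ring.
    + right. apply (Rmult_cancel_l (b * c * p)); [apply Rgt_not_eq; repeat apply Rmult_lt_0_compat; auto |].
      transitivity ((c * p * s) * q * b); [ring |].
      rewrite <- R4. transitivity ((b * h * q) * a * p); [ring |].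
      rewrite R2; ring.
  - split; [| split; [| left; lra]]; apply symmetric4_of_equal_ratios; auto.
    + right. apply (Rmult_cancel_l (q * b * s)); [apply Rgt_not_eq; repeat apply Rmult_lt_0_compat; auto |].
      transitivity ((s * f * b) * c * q); [ring |].
      rewrite <- R3. transitivity ((c * q * r) * g * s); [ring |].
      rewrite <- R2; ring.
    + left. apply (Rmult_cancel_l (q * s * h)); [apply Rgt_not_eq; repeat apply Rmult_lt_0_compat; auto |].
      transitivity ((b * h * q) * e * s); [ring |].
      rewrite R2. transitivity ((c * e * s) * q * r); [ring |].
      rewrite <- R4; ring.
Qed.

(** The left side comes from a quadratic form in [p * r] and [q * s], found below, which are
    proportional to [N1 / D1] and [N2 / D2]; denominators are cleared. *)
Lemma resultant_factorization (a b c h r s si th om : R) :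
  is_sign si -> is_sign th -> is_sign om ->
  let D1 := c * s - th * si * a * h in
  let D2 := c * r + om * si * b * h in
  let N1 := th * b - si * r in
  let N2 := om * a + si * s in
  (s ^ 2 - a ^ 2) * N1 ^ 2 * D2 ^ 2 + (r ^ 2 - b ^ 2) * N2 ^ 2 * D1 ^ 2
  + (r ^ 2 - b ^ 2 + s ^ 2 - a ^ 2 - h ^ 2 + c ^ 2) * N1 * N2 * D1 * D2
  = N1 * N2 * (h - om * th * c)
    * B a b c h r s (- (si * om)) (- (om * th)) (si * th).
Proof.
  intros [-> | ->] [-> | ->] [-> | ->]; cbv zeta; unfold B; ring.
Qed.

(** The three signs have product 1, which leaves just the four triples of the product. *)
Lemma B_product_zero (a b c h r s si th om : R) :
  is_sign si -> is_sign th -> is_sign om ->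
  B a b c h r s (- (si * om)) (- (om * th)) (si * th) = 0 ->
  B a b c h r s 1 1 1 * B a b c h r s 1 (-1) (-1) *
  B a b c h r s (-1) 1 (-1) * B a b c h r s (-1) (-1) 1 = 0.
Proof.
  intros [-> | ->] [-> | ->] [-> | ->];
  repeat rewrite ?Rmult_1_l, ?Rmult_1_r, ?Ropp_involutive;
  replace (-1 * -1) with 1 by ring; replace (- (1)) with (-1) by ring;
  replace (- (-1)) with 1 by ring; intros ->; ring.
Qed.

Lemma symmetric_or_B_product_zero_supplementary (a b c d e f g h p q r s si : R) :
  0 < a -> 0 < b -> 0 < c -> 0 < d -> 0 < e -> 0 < f ->
  0 < g -> 0 < h -> 0 < p -> 0 < q -> 0 < r -> 0 < s -> is_sign si ->
  q * g * e = p * f * d -> b * h * q = c * d * r ->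
  r * g * a = s * f * b -> a * h * p = c * e * s ->
  zero_sum4 c f h g -> zero_sum4 b p r e -> zero_sum4 s q a d ->
  (p + si * r) ^ 2 = (b + si * e) ^ 2 ->
  (q - si * s) ^ 2 = (a - si * d) ^ 2 ->
  (p ^ 2 + q ^ 2 - c ^ 2) * (r * s) = - (r ^ 2 + s ^ 2 - h ^ 2) * (p * q) ->
  (a ^ 2 + b ^ 2 - c ^ 2) * (d * e) = - (d ^ 2 + e ^ 2 - h ^ 2) * (a * b) ->
  all_symmetric a b c d e f g h p q r s \/
  B a b c h r s 1 1 1 * B a b c h r s 1 (-1) (-1) *
  B a b c h r s (-1) 1 (-1) * B a b c h r s (-1) (-1) 1 = 0.
Proof.
  intros pa pb pc pd pe pf pg ph pp pq pr ps Hsi R1 R2 R3 R4 Z1 Z2 Z3 X Y V1 V6.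
  destruct (sign_of_sqr_eq _ _ X) as (th & Hth & X').
  destruct (sign_of_sqr_eq _ _ Y) as (om & Hom & Y').
  (* Eliminating [e] from [X'] by [R4], and [d] from [Y'] by [R2], gives [p * D1 = c * s * N1] and
     [q * D2 = c * r * N2]. *)
  pose (D1 := c * s - th * si * a * h).
  pose (D2 := c * r + om * si * b * h).
  pose (N1 := th * b - si * r).
  pose (N2 := om * a + si * s).
  assert (P1 : p * D1 = c * s * N1).
  { unfold D1, N1.
    transitivity (c * s * (p + si * r) - th * si * (a * h * p) - c * s * si * r); [ring |].
    rewrite X', R4; ring. }
  assert (Q1 : q * D2 = c * r * N2).
  { unfold D2, N2.
    transitivity (c * r * (q - si * s) + om * si * (b * h * q) + c * r * si * s); [ring |].
    rewrite Y', R2; ring. }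
  (* The angle conditions at [v1] and [v6], with [d] and [e] eliminated through
     [R2] and [R4]; the difference of the two is a quadratic form in [p * r] and
     [q * s]. *)
  assert (W6 : r * s * p * q * (a ^ 2 + b ^ 2 - c ^ 2) + (b * q * s) ^ 2
               + (a * p * r) ^ 2 = (c * r * s) ^ 2).
  { apply (Rmult_cancel_l (a * b * h ^ 2)); [apply Rgt_not_eq; repeat apply Rmult_lt_0_compat; lra |].
    transitivity ((a ^ 2 + b ^ 2 - c ^ 2) * (b * h * q) * (a * h * p) * r * s
      + a * b * s ^ 2 * (b * h * q) ^ 2 + a * b * r ^ 2 * (a * h * p) ^ 2); [ring |].
    rewrite R2, R4.
    transitivity ((a ^ 2 + b ^ 2 - c ^ 2) * (d * e) * (c * r * s) ^ 2
      + a * b * (d ^ 2 + e ^ 2) * (c * r * s) ^ 2); [ring |].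
    rewrite V6; ring. }
  assert (W : (s ^ 2 - a ^ 2) * (p * r) ^ 2 + (r ^ 2 - b ^ 2) * (q * s) ^ 2
     + (r ^ 2 - b ^ 2 + s ^ 2 - a ^ 2 - h ^ 2 + c ^ 2) * (p * r) * (q * s) = 0).
  { transitivity (r * s * ((p ^ 2 + q ^ 2 - c ^ 2) * (r * s)
        + (r ^ 2 + s ^ 2 - h ^ 2) * (p * q))
      + (c * r * s) ^ 2 - (r * s * p * q * (a ^ 2 + b ^ 2 - c ^ 2)
        + (b * q * s) ^ 2 + (a * p * r) ^ 2)); [ring |].
    rewrite W6, V1; ring. }
  pose proof (resultant_factorization a b c h r s si th om Hsi Hth Hom) as T.
  cbv zeta in T; fold D1 D2 N1 N2 in T.
  assert (T0 : N1 * N2 * (h - om * th * c)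
    * B a b c h r s (- (si * om)) (- (om * th)) (si * th) = 0).
  (* Multiplied by [(c * r * s) ^ 2], the left side becomes the form in [W] times [D1 ^ 2 * D2 ^ 2],
     by [P1] and [Q1]. *)
  { rewrite <- T.
    apply (Rmult_cancel_l ((c * r * s) ^ 2)); [apply Rgt_not_eq, pow_lt; repeat apply Rmult_lt_0_compat; lra |].
    transitivity ((s ^ 2 - a ^ 2) * (r * (c * s * N1)) ^ 2 * D2 ^ 2
      + (r ^ 2 - b ^ 2) * (s * (c * r * N2)) ^ 2 * D1 ^ 2
      + (r ^ 2 - b ^ 2 + s ^ 2 - a ^ 2 - h ^ 2 + c ^ 2)
         * (r * (c * s * N1)) * (s * (c * r * N2)) * D1 * D2); [ring |].
    rewrite <- P1, <- Q1.
    transitivity (((s ^ 2 - a ^ 2) * (p * r) ^ 2 + (r ^ 2 - b ^ 2) * (q * s) ^ 2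
     + (r ^ 2 - b ^ 2 + s ^ 2 - a ^ 2 - h ^ 2 + c ^ 2) * (p * r) * (q * s))
       * (D1 ^ 2 * D2 ^ 2)); [ring |].
    rewrite W; ring. }
  assert (Opp : (c = h /\ f = g) \/ (b = r /\ p = e) \/ (s = a /\ q = d) ->
    all_symmetric a b c d e f g h p q r s)
    by (apply all_symmetric_of_opposite_equal; assumption).
  destruct (Rmult_integral _ _ T0) as [T1 | T1];
    [| right; apply (B_product_zero a b c h r s si th om); assumption].
  destruct (Rmult_integral _ _ T1) as [T2 | T2];
    [destruct (Rmult_integral _ _ T2) as [T3 | T3] |].
  (* By positivity [N1 = 0] means [th = si] and [b = r], whence [p = e] by [X']; likewise [N2 = 0]
     gives [a = s] and [q = d]. *)
  - left; apply Opp; right; left; unfold N1 in T3.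
    destruct Hsi as [-> | ->], Hth as [-> | ->]; lra.
  - left; apply Opp; right; right; unfold N2 in T3.
    destruct Hsi as [-> | ->], Hom as [-> | ->]; lra.
  - (* Here [h = c] and [th = om]; this sign is 1, because for [th = -1] the
       first relation forces [si = -1] and for [om = -1] the second forces
       [si = 1]. *)
    assert (ET : h = c /\ th = 1 /\ om = 1)
      by (clear - Hsi Hth Hom T2 X' Y' pa pb pc pd pe pg ph pp pq pr ps;
          destruct Hsi as [-> | ->], Hth as [-> | ->], Hom as [-> | ->]; lra).
    destruct ET as (-> & -> & ->).
    (* The factor [h - om * th * c] vanishes here, so [B] is extracted from the angle condition at
       [v1] alone. *)
    set (M := (s - si * a) * (r + si * b)).
    assert (P2 : p * (s - si * a) = s * (b - si * r)).
    { apply (Rmult_cancel_l c); [lra |]. transitivity (p * D1); [unfold D1; ring |].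
      rewrite P1; unfold N1; ring. }
    assert (Q2 : q * (r + si * b) = r * (a + si * s)).
    { apply (Rmult_cancel_l c); [lra |]. transitivity (q * D2); [unfold D2; ring |].
      rewrite Q1; unfold N2; ring. }
    assert (E1 : M * (p * q + r * s) = 2 * r * s * (b * s - a * r) * si).
    { transitivity ((p * (s - si * a)) * (q * (r + si * b)) + M * r * s);
        [unfold M; ring |].
      rewrite P2, Q2; unfold M; destruct Hsi as [-> | ->]; ring. }
    assert (E2 : M * (p * r + q * s) = r * s * (b ^ 2 - r ^ 2 + s ^ 2 - a ^ 2) * si).
    { transitivity ((p * (s - si * a)) * r * (r + si * b)
        + (q * (r + si * b)) * s * (s - si * a)); [unfold M; ring |].
      rewrite P2, Q2; destruct Hsi as [-> | ->]; ring. }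
    assert (E3 : M * (p * s + q * r) = (s * b - r * a) * (s * b + r * a) * si).
    { transitivity ((p * (s - si * a)) * s * (r + si * b)
        + (q * (r + si * b)) * r * (s - si * a)); [unfold M; ring |].
      rewrite P2, Q2; destruct Hsi as [-> | ->]; ring. }
    (* Supplementary angles over the common side [c] make a cyclic quadrilateral; this is the
       formula for its diagonal. *)
    assert (E4 : c ^ 2 * (p * q + r * s) = (p * r + q * s) * (p * s + q * r)) by lra.
    assert (E5 : (s * b - r * a)
      * (2 * c ^ 2 * M * si - (b ^ 2 - r ^ 2 + s ^ 2 - a ^ 2) * (s * b + r * a)) = 0).
    { apply (Rmult_cancel_l (r * s)); [nra |].
      transitivity (c ^ 2 * M * (2 * r * s * (b * s - a * r) * si)
        - (r * s * (b ^ 2 - r ^ 2 + s ^ 2 - a ^ 2) * si)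
          * ((s * b - r * a) * (s * b + r * a) * si));
        [destruct Hsi as [-> | ->]; ring |].
      rewrite <- E1, <- E2, <- E3.
      transitivity (M ^ 2 * (c ^ 2 * (p * q + r * s)
        - (p * r + q * s) * (p * s + q * r))); [ring |].
      rewrite E4; ring. }
    destruct (Rmult_integral _ _ E5) as [F | F].
    (* Now [E1] forces [M = 0]: for [si = 1] this means [s = a], and [P2] gives [b = r]; for
       [si = -1] it means [r = b], and [Q2] gives [a = s]. *)
    + left; apply Opp.
      assert (M0 : M = 0).
      { apply (Rmult_cancel_l (p * q + r * s)); [nra |].
        rewrite Rmult_comm, E1. replace (b * s - a * r) with 0 by lra. ring. }
      clear - M0 P2 Q2 X' Y' Hsi pa pb pr ps; unfold M in M0.
      right; destruct Hsi as [-> | ->];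
        destruct (Rmult_integral _ _ M0) as [Z | Z]; try lra.
      * left. assert (s * (b - 1 * r) = 0) by (rewrite <- P2, Z; ring).
        assert (b - 1 * r = 0) by (apply (Rmult_cancel_l s); lra). lra.
      * right. assert (r * (a + -1 * s) = 0) by (rewrite <- Q2, Z; ring).
        assert (a + -1 * s = 0) by (apply (Rmult_cancel_l r); lra). lra.
    (* The second factor of [E5] is [B] up to the nonzero multiple [- (c * si)]. *)
    + right; apply (B_product_zero a b c c r s si 1 1); try assumption;
        try (left; reflexivity).
      transitivity (- (c * si) * (2 * c ^ 2 * M * si
        - (b ^ 2 - r ^ 2 + s ^ 2 - a ^ 2) * (s * b + r * a))).
      * unfold M, B; destruct Hsi as [-> | ->]; ring.
      * rewrite F; ring.
Qed.

(** * Functions along a flex *)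

Definition subinterval (u' v' u v : R) : Prop := u <= u' /\ u' < v' /\ v' <= v.

Definition flexing (X : R -> R) (u v : R) : Prop :=
  (forall t, u < t < v -> continuity_pt X t) /\
  (forall x y, u < x -> x < y -> y < v ->
     ~ exists k, forall t, x <= t <= y -> X t = k).

Lemma flexing_sub X u v u' v' :
  subinterval u' v' u v -> flexing X u v -> flexing X u' v'.
Proof.
  intros (S1 & S2 & S3) [C N]; split.
  - intros t Ht; apply C; lra.
  - intros x y Hx Hxy Hy; apply N; lra.
Qed.

Lemma flexing_not_constant X u v k :
  u < v -> flexing X u v -> ~ (forall t, u < t < v -> X t = k).
Proof.
  intros Huv [_ N] H.
  apply (N (u + (v - u) / 3) (u + 2 * (v - u) / 3)); try lra.
  exists k; intros t Ht; apply H; lra.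
Qed.

Lemma flexing_affine X u v a b :
  b <> 0 -> flexing X u v -> flexing (fun t => a + b * X t) u v.
Proof.
  intros Hb [C N]; split.
  - intros t Ht; apply continuity_pt_plus.
    + apply continuity_pt_const; intros ? ?; reflexivity.
    + apply continuity_pt_scal, C, Ht.
  - intros x y Hx Hxy Hy [k Hk]; apply (N x y Hx Hxy Hy).
    exists ((k - a) / b); intros t Ht; rewrite <- (Hk t Ht); field; exact Hb.
Qed.

(** If [f] is nonzero at a point, continuity keeps it nonzero nearby, and [g] vanishes there. *)
Lemma product_zero_split (f g : R -> R) (u v : R) :
  u < v -> (forall t, u < t < v -> continuity_pt f t) ->
  (forall t, u < t < v -> f t * g t = 0) ->
  exists u' v', subinterval u' v' u v /\
    ((forall t, u' < t < v' -> f t = 0) \/ (forall t, u' < t < v' -> g t = 0)).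
Proof.
  intros Huv C H.
  destruct (classic (forall t, u < t < v -> f t = 0)) as [Z | Z].
  - exists u, v; split; [unfold subinterval; lra | left; exact Z].
  - apply not_all_ex_not in Z; destruct Z as [t Z].
    apply imply_to_and in Z; destruct Z as [Ht Z].
    destruct (continuous_neq_0 f t (C t Ht) Z) as [[eps Heps] Hn]; simpl in Hn.
    exists (Rmax u (t - eps)), (Rmin v (t + eps)); split.
    + unfold subinterval, Rmax, Rmin; destruct Rle_dec, Rle_dec; lra.
    + right; intros x Hx.
      assert (u < x < v /\ t - eps < x < t + eps) as [Hx1 Hx2]
        by (revert Hx; unfold Rmax, Rmin; destruct Rle_dec, Rle_dec; lra).
      destruct (Rmult_integral _ _ (H x Hx1)) as [F | F]; [| exact F].
      exfalso; apply (Hn (x - t)); [apply Rabs_def1; lra |].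
      replace (t + (x - t)) with x by ring; exact F.
Qed.

(** A flexing function cannot stay equal to [k], which excludes the first case of
    [product_zero_split]. *)
Lemma flexing_factor X (q : R -> R) u v k :
  u < v -> flexing X u v ->
  (forall t, u < t < v -> (X t - k) * q t = 0) ->
  exists u' v', subinterval u' v' u v /\ (forall t, u' < t < v' -> q t = 0).
Proof.
  intros Huv F H.
  destruct (product_zero_split (fun t => - k + 1 * X t) q u v) as (u' & v' & S & [Z | Z]).
  - exact Huv.
  - exact (proj1 (flexing_affine X u v (- k) 1 R1_neq_R0 F)).
  - intros t Ht; rewrite <- (H t Ht); ring.
  - exfalso; apply (flexing_not_constant X u' v' k).
    + destruct S; tauto.
    + apply (flexing_sub X u v); assumption.
    + intros t Ht; specialize (Z t Ht); lra.
  - exists u', v'; split; assumption.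
Qed.

Lemma flexing_linear X u v c0 c1 :
  u < v -> flexing X u v -> (forall t, u < t < v -> c0 + c1 * X t = 0) ->
  c0 = 0 /\ c1 = 0.
Proof.
  intros Huv F H.
  assert (c1 = 0).
  { apply NNPP; intros N; apply (flexing_not_constant X u v (- c0 / c1) Huv F).
    intros t Ht; specialize (H t Ht).
    apply (Rmult_cancel_l c1); [exact N |]; field_simplify; lra. }
  subst c1; specialize (H ((u + v) / 2)); lra.
Qed.

(* Subtracting the value at one point and dividing by [X - a] lowers the degree
   and keeps the leading coefficient. *)
Lemma flexing_quartic X u v c0 c1 c2 c3 c4 :
  u < v -> flexing X u v ->
  (forall t, u < t < v ->
     c0 + c1 * X t + c2 * X t ^ 2 + c3 * X t ^ 3 + c4 * X t ^ 4 = 0) ->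
  c0 = 0 /\ c1 = 0 /\ c2 = 0 /\ c3 = 0 /\ c4 = 0.
Proof.
  assert (L2 : forall u v c0 c1 c2, u < v -> flexing X u v ->
    (forall t, u < t < v -> c0 + c1 * X t + c2 * X t ^ 2 = 0) ->
    c0 = 0 /\ c1 = 0 /\ c2 = 0).
  { clear; intros u v c0 c1 c2 Huv F H; set (a := X ((u + v) / 2)).
    destruct (flexing_factor X (fun t => (c1 + c2 * a) + c2 * X t) u v a Huv F)
      as (u' & v' & S & Q).
    { intros t Ht; pose proof (H t Ht); pose proof (H ((u + v) / 2) ltac:(lra)) as Ha.
      fold a in Ha; ring_simplify; lra. }
    assert (c2 = 0).
    { refine (proj2 (flexing_linear X u' v' _ _ _ _ Q)); [destruct S; tauto |].
      apply (flexing_sub X u v); assumption. }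
    subst c2; destruct (flexing_linear X u v c0 c1 Huv F); [| lra].
    intros t Ht; specialize (H t Ht); lra. }
  assert (L3 : forall u v c0 c1 c2 c3, u < v -> flexing X u v ->
    (forall t, u < t < v -> c0 + c1 * X t + c2 * X t ^ 2 + c3 * X t ^ 3 = 0) ->
    c0 = 0 /\ c1 = 0 /\ c2 = 0 /\ c3 = 0).
  { clear - L2; intros u v c0 c1 c2 c3 Huv F H; set (a := X ((u + v) / 2)).
    destruct (flexing_factor X (fun t => (c1 + c2 * a + c3 * a ^ 2)
        + (c2 + c3 * a) * X t + c3 * X t ^ 2) u v a Huv F) as (u' & v' & S & Q).
    { intros t Ht; pose proof (H t Ht); pose proof (H ((u + v) / 2) ltac:(lra)) as Ha.
      fold a in Ha; ring_simplify; lra. }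
    assert (c3 = 0).
    { refine (proj2 (proj2 (L2 u' v' _ _ _ _ _ Q))); [destruct S; tauto |].
      apply (flexing_sub X u v); assumption. }
    subst c3; destruct (L2 u v c0 c1 c2 Huv F); [| lra].
    intros t Ht; specialize (H t Ht); lra. }
  intros Huv F H; set (a := X ((u + v) / 2)).
  destruct (flexing_factor X (fun t => (c1 + c2 * a + c3 * a ^ 2 + c4 * a ^ 3)
      + (c2 + c3 * a + c4 * a ^ 2) * X t + (c3 + c4 * a) * X t ^ 2
      + c4 * X t ^ 3) u v a Huv F) as (u' & v' & S & Q).
  { intros t Ht; pose proof (H t Ht); pose proof (H ((u + v) / 2) ltac:(lra)) as Ha.
    fold a in Ha; ring_simplify; lra. }
  assert (c4 = 0).
  { refine (proj2 (proj2 (proj2 (L3 u' v' _ _ _ _ _ _ Q)))); [destruct S; tauto |].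
    apply (flexing_sub X u v); assumption. }
  subst c4; destruct (L3 u v c0 c1 c2 c3 Huv F); [| lra].
  intros t Ht; specialize (H t Ht); lra.
Qed.

(** * Hyperbolas between two functions along a flex *)

Definition hyperbola (X Y : R -> R) (x0 y0 k u v : R) : Prop :=
  forall t, u < t < v -> (X t - x0) * (Y t - y0) = k.

Lemma hyperbola_sym X Y x0 y0 k u v :
  hyperbola X Y x0 y0 k u v -> hyperbola Y X y0 x0 k u v.
Proof. intros H t Ht; rewrite Rmult_comm; exact (H t Ht). Qed.

Lemma hyperbola_sub X Y x0 y0 k u v u' v' :
  subinterval u' v' u v -> hyperbola X Y x0 y0 k u v ->
  hyperbola X Y x0 y0 k u' v'.
Proof. intros (S1 & S2 & S3) H t Ht; apply H; lra. Qed.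

Lemma hyperbola_nonzero X Y x0 y0 k u v :
  u < v -> flexing X u v -> flexing Y u v -> hyperbola X Y x0 y0 k u v -> k <> 0.
Proof.
  intros Huv FX FY H ->.
  destruct (flexing_factor X (fun t => Y t - y0) u v x0 Huv FX H) as (u' & v' & S & Z).
  apply (flexing_not_constant Y u' v' y0).
  - destruct S; tauto.
  - apply (flexing_sub Y u v); assumption.
  - intros t Ht; specialize (Z t Ht); lra.
Qed.

(** Multiplying the second equation by [X - x1] and using the first leaves a quadratic polynomial in
    [X - x1], whose coefficients vanish. *)
Lemma hyperbola_unique X Y x1 y1 k1 x2 y2 k2 u v :
  u < v -> flexing X u v -> flexing Y u v ->
  hyperbola X Y x1 y1 k1 u v -> hyperbola X Y x2 y2 k2 u v ->
  x1 = x2 /\ y1 = y2 /\ k1 = k2.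
Proof.
  intros Huv FX FY H1 H2.
  pose proof (hyperbola_nonzero X Y x1 y1 k1 u v Huv FX FY H1) as K.
  destruct (flexing_quartic (fun t => - x1 + 1 * X t) u v ((x1 - x2) * k1)
    (k1 + (x1 - x2) * (y1 - y2) - k2) (y1 - y2) 0 0 Huv) as (E0 & E1 & E2 & _).
  - apply flexing_affine; [lra | exact FX].
  - intros t Ht; pose proof (H1 t Ht) as G1; pose proof (H2 t Ht) as G2.
    transitivity ((X t - x1) * ((X t - x2) * (Y t - y2) - k2)
      + (x1 - x2 + X t - x1) * (k1 - (X t - x1) * (Y t - y1))); [ring |].
    rewrite G1, G2; ring.
  - assert (x1 = x2) by (destruct (Rmult_integral _ _ E0); lra).
    assert (y1 = y2) by lra.
    repeat split; try assumption; subst; lra.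
Qed.

(** [Y] and [Z] are fractional linear functions of [X]; eliminating [X] gives an affine relation if
    their poles coincide and a hyperbola otherwise. *)
Lemma hyperbola_eliminate X Y Z x1 y1 k1 x3 z3 k3 u v :
  u < v -> flexing X u v -> flexing Y u v -> flexing Z u v ->
  hyperbola X Y x1 y1 k1 u v -> hyperbola X Z x3 z3 k3 u v ->
  (forall t, u < t < v -> k3 * (Y t - y1) = k1 * (Z t - z3)) \/
  (x1 <> x3 /\
   hyperbola Y Z (y1 - k1 / (x1 - x3)) (z3 + k3 / (x1 - x3))
     (- (k1 * k3) / (x1 - x3) ^ 2) u v).
Proof.
  intros Huv FX FY FZ H1 H3.
  pose proof (hyperbola_nonzero X Y x1 y1 k1 u v Huv FX FY H1) as K1.
  pose proof (hyperbola_nonzero X Z x3 z3 k3 u v Huv FX FZ H3) as K3.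
  destruct (Req_dec x1 x3) as [E | E].
  - left; intros t Ht; subst x3.
    rewrite <- (H1 t Ht), <- (H3 t Ht); ring.
  - right; split; [exact E |]; intros t Ht.
    assert (N1 : X t - x1 <> 0)
      by (intros N; apply K1; rewrite <- (H1 t Ht), N; ring).
    assert (N3 : X t - x3 <> 0)
      by (intros N; apply K3; rewrite <- (H3 t Ht), N; ring).
    assert (Y t = y1 + k1 / (X t - x1)) as -> by (rewrite <- (H1 t Ht); field; exact N1).
    assert (Z t = z3 + k3 / (X t - x3)) as -> by (rewrite <- (H3 t Ht); field; exact N3).
    field; repeat split; lra.
Qed.

(** An affine relation between [Y] and [Z] would give a quadratic equation for [Y] with leading
    coefficient [k3]. Otherwise uniqueness determines [k2], and the product is minus a nonzero
    square. *)
Lemma hyperbola_triangle_sign X Y Z x1 y1 k1 x3 z3 k3 y2 z2 k2 u v :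
  u < v -> flexing X u v -> flexing Y u v -> flexing Z u v ->
  hyperbola X Y x1 y1 k1 u v -> hyperbola X Z x3 z3 k3 u v ->
  hyperbola Y Z y2 z2 k2 u v -> k1 * k2 * k3 < 0.
Proof.
  intros Huv FX FY FZ H1 H3 H2.
  pose proof (hyperbola_nonzero X Y x1 y1 k1 u v Huv FX FY H1) as K1.
  pose proof (hyperbola_nonzero X Z x3 z3 k3 u v Huv FX FZ H3) as K3.
  destruct (hyperbola_eliminate X Y Z x1 y1 k1 x3 z3 k3 u v Huv FX FY FZ H1 H3)
    as [L | [E H2']].
  - exfalso.
    destruct (flexing_quartic Y u v (k3 * y1 * y2 - k1 * (z3 - z2) * y2 - k1 * k2)
      (- k3 * (y1 + y2) + k1 * (z3 - z2)) k3 0 0 Huv FY) as (_ & _ & E & _);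
      [| exact (K3 E)].
    intros t Ht; pose proof (H2 t Ht) as G; rewrite <- G.
    transitivity ((Y t - y2) * (k3 * (Y t - y1) - k1 * (Z t - z3))); [ring |].
    rewrite (L t Ht); ring.
  - destruct (hyperbola_unique Y Z _ _ _ _ _ _ u v Huv FY FZ H2 H2') as (_ & _ & ->).
    replace (k1 * (- (k1 * k3) / (x1 - x3) ^ 2) * k3)
      with (- (k1 * k3 / (x1 - x3)) ^ 2) by (field; lra).
    assert (k1 * k3 / (x1 - x3) <> 0).
    { unfold Rdiv; repeat apply Rmult_integral_contrapositive_currified;
        try assumption; apply Rinv_neq_0_compat; lra. }
    pose proof (pow2_gt_0 _ H); lra.
Qed.

(** * The Gram determinant of four unit vectors *)

(* The Gram determinant of four unit vectors with consecutive products
   [C1], [C2], [C3], [C4] (cyclically) and diagonal products [X], [Y]. *)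
Definition gram (C1 C2 C3 C4 X Y : R) : R :=
  X ^ 2 * Y ^ 2 - X ^ 2 - Y ^ 2 + 2 * X * (C1 * C2 + C3 * C4)
  + 2 * Y * (C1 * C4 + C2 * C3) - 2 * X * Y * (C1 * C3 + C2 * C4)
  + 1 - (C1 ^ 2 + C2 ^ 2 + C3 ^ 2 + C4 ^ 2) + (C1 * C3 - C2 * C4) ^ 2.

(** Each factor is a hyperbola in the diagonal cosines, centred at [(-1, -e)] or [(1, e)]. *)
Lemma gram_factorization (e C1 C2 X Y : R) :
  is_sign e ->
  gram C1 C2 (e * C1) (e * C2) X Y =
  ((X + 1) * (Y + e) - e * (C1 + C2) ^ 2) *
  ((X - 1) * (Y - e) - e * (C1 - C2) ^ 2).
Proof. intros [-> | ->]; unfold gram; ring. Qed.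

(** On a line only the term [X ^ 2 * Y ^ 2] has degree four in [Y], with coefficient [b ^ 2]. *)
Lemma gram_not_linear C1 C2 C3 C4 X Y a b u v :
  u < v -> flexing Y u v -> b <> 0 ->
  (forall t, u < t < v -> X t = a + b * Y t) ->
  ~ (forall t, u < t < v -> gram C1 C2 C3 C4 (X t) (Y t) = 0).
Proof.
  intros Huv FY Hb L H.
  destruct (flexing_quartic Y u v (gram C1 C2 C3 C4 a 0)
    (2 * b * (C1 * C2 + C3 * C4) - 2 * a * b + 2 * (C1 * C4 + C2 * C3)
     - 2 * a * (C1 * C3 + C2 * C4))
    (a ^ 2 - b ^ 2 - 1 - 2 * b * (C1 * C3 + C2 * C4)) (2 * a * b) (b ^ 2) Huv FY)
    as (_ & _ & _ & _ & E).
  - intros t Ht; pose proof (H t Ht) as G; rewrite (L t Ht) in G.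
    etransitivity; [| exact G]; unfold gram; ring.
  - apply (pow_nonzero b 2 Hb E).
Qed.

(* On the hyperbola the determinant is a Laurent polynomial in [X - X0]; its
   extreme coefficients give [X0 ^ 2 = Y0 ^ 2 = 1], the others the relations
   between the [Ci]. *)
Lemma gram_hyperbola C1 C2 C3 C4 X Y X0 Y0 K u v :
  u < v -> flexing X u v -> flexing Y u v ->
  C1 ^ 2 < 1 -> C2 ^ 2 < 1 ->
  hyperbola X Y X0 Y0 K u v ->
  (forall t, u < t < v -> gram C1 C2 C3 C4 (X t) (Y t) = 0) ->
  exists e, is_sign e /\ C3 = e * C1 /\ C4 = e * C2.
Proof.
  intros Huv FX FY B1 B2 H G.
  pose proof (hyperbola_nonzero X Y X0 Y0 K u v Huv FX FY H) as HK.
  set (m := C1 * C2 + C3 * C4); set (n := C1 * C4 + C2 * C3).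
  set (w := C1 * C3 + C2 * C4); set (A := X0 * Y0 + K).
  set (c := 1 - (C1 ^ 2 + C2 ^ 2 + C3 ^ 2 + C4 ^ 2) + (C1 * C3 - C2 * C4) ^ 2).
  destruct (flexing_quartic (fun t => - X0 + 1 * X t) u v
    ((X0 ^ 2 - 1) * K ^ 2) ((2 * A * X0 - 2 * Y0 + 2 * n - 2 * w * X0) * K)
    (A ^ 2 + 2 * X0 * Y0 * K - X0 ^ 2 - Y0 ^ 2 + 2 * m * X0 + 2 * n * Y0
      - 2 * w * A + c)
    (2 * A * Y0 - 2 * X0 + 2 * m - 2 * w * Y0) (Y0 ^ 2 - 1) Huv)
    as (E0 & E1 & E2 & E3 & E4).
  - apply flexing_affine; [lra | exact FX].
  - intros t Ht; pose proof (H t Ht) as HH; pose proof (G t Ht) as GG.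
    assert (N : X t - X0 <> 0) by (intros N; apply HK; rewrite <- HH, N; ring).
    rewrite <- (Rmult_0_r ((X t - X0) ^ 2)), <- GG.
    unfold gram, A, m, n, w, c; rewrite <- HH; ring.
  - assert (HX : X0 ^ 2 = 1).
    { destruct (Rmult_integral _ _ E0) as [F | F]; [lra |].
      exfalso; exact (pow_nonzero K 2 HK F). }
    assert (HY : Y0 ^ 2 = 1) by lra.
    assert (E1' : A * X0 - Y0 + n - w * X0 = 0)
      by (destruct (Rmult_integral _ _ E1); lra).
    replace K with (A - X0 * Y0) in E2 by (unfold A; ring).
    clearbody A.
    assert (SX : is_sign X0) by (destruct (sign_of_sqr_eq X0 1) as (e & [-> | ->] & ->);
      [lra | left; lra | right; lra]).
    assert (SY : is_sign Y0) by (destruct (sign_of_sqr_eq Y0 1) as (e & [-> | ->] & ->);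
      [lra | left; lra | right; lra]).
    clear - SX SY E1' E2 E3 B1 B2.
    (* [E1'] and [E3] both determine [A]; comparing them relates [m] to [n], and [E2] then gives
       [m ^ 2]. *)
    assert (M : m = X0 * Y0 * n /\ m ^ 2 = (w - X0 * Y0) ^ 2 - c).
    { destruct SX as [-> | ->], SY as [-> | ->].
      - assert (A = 1 + w - m) as -> by lra. split; [lra |].
        assert (n = m) as F by lra; rewrite F in E2; lra.
      - assert (A = -1 + w + m) as -> by lra. split; [lra |].
        assert (n = - m) as F by lra; rewrite F in E2; lra.
      - assert (A = -1 + w - m) as -> by lra. split; [lra |].
        assert (n = - m) as F by lra; rewrite F in E2; lra.
      - assert (A = 1 + w + m) as -> by lra. split; [lra |].
        assert (n = m) as F by lra; rewrite F in E2; lra. }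
    destruct M as [M1 M2].
    exists (X0 * Y0).
    assert (S : is_sign (X0 * Y0))
      by (destruct SX as [-> | ->], SY as [-> | ->]; unfold is_sign; lra).
    split; [exact S |].
    set (e := X0 * Y0) in *; clearbody e.
    (* The relation [m = e * n] factors. *)
    assert (F : (C1 - e * C3) * (C2 - e * C4) = 0)
      by (unfold m, n in M1; destruct S as [-> | ->]; lra).
    assert (Fe : forall x y, x - e * y = 0 -> y = e * x)
      by (intros x y; destruct S as [-> | ->]; lra).
    destruct (Rmult_integral _ _ F) as [F' | F']; apply Fe in F'.
    + split; [exact F' |].
      assert (Q : (1 - C1 ^ 2) * (C4 - e * C2) ^ 2 = 0)
        by (unfold m, w, c in M2; rewrite F' in M2; destruct S as [-> | ->]; lra).
      destruct (Rmult_integral _ _ Q) as [Q' | Q']; [lra |].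
      apply Rmult_integral in Q'; destruct Q' as [Q' | Q']; lra.
    + split; [| exact F'].
      assert (Q : (1 - C2 ^ 2) * (C3 - e * C1) ^ 2 = 0)
        by (unfold m, w, c in M2; rewrite F' in M2; destruct S as [-> | ->]; lra).
      destruct (Rmult_integral _ _ Q) as [Q' | Q']; [lra |].
      apply Rmult_integral in Q'; destruct Q' as [Q' | Q']; lra.
Qed.

(** * Stars of vertices *)

(** The third side enters by its square because the diagonals are followed by their squared
    lengths. *)
Definition cosine_sq (x y z2 : R) : R := (x ^ 2 + y ^ 2 - z2) / (2 * x * y).

Definition cosine (x y z : R) : R := cosine_sq x y (z ^ 2).

(** This carries the centres of the hyperbolas from diagonal cosines to squared diagonals. *)
Lemma cosine_sq_shift x y z2 (e : R) :
  0 < x -> 0 < y -> is_sign e ->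
  z2 - (x + e * y) ^ 2 = - (2 * x * y) * (cosine_sq x y z2 + e).
Proof. intros px py [-> | ->]; unfold cosine_sq; field; lra. Qed.

Lemma cosine_bound x y z :
  0 < x -> 0 < y -> 0 < z -> z < x + y -> x < z + y -> y < z + x ->
  -1 < cosine x y z < 1.
Proof.
  intros px py pz H1 H2 H3.
  assert (0 < / (2 * x * y)) by (apply Rinv_0_lt_compat; nra).
  assert (0 < (z - x + y) * (z + x - y) * / (2 * x * y))
    by (repeat apply Rmult_lt_0_compat; lra).
  assert (0 < (x + y - z) * (x + y + z) * / (2 * x * y))
    by (repeat apply Rmult_lt_0_compat; lra).
  replace (cosine x y z) with (1 - (z - x + y) * (z + x - y) * / (2 * x * y)) at 2
    by (unfold cosine, cosine_sq; field; lra).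
  replace (cosine x y z) with ((x + y - z) * (x + y + z) * / (2 * x * y) - 1)
    by (unfold cosine, cosine_sq; field; lra).
  lra.
Qed.

(** The sum equals 1 plus the ratio of the inradius to the circumradius. *)
Lemma cosine_sum_pos x y z :
  0 < x -> 0 < y -> 0 < z -> z < x + y -> x < z + y -> y < z + x ->
  0 < cosine x y z + cosine y z x + cosine z x y.
Proof.
  intros px py pz H1 H2 H3.
  replace (cosine x y z + cosine y z x + cosine z x y)
    with (((y + z - x) * (z + x - y) * (x + y - z) + 2 * x * y * z)
      * / (2 * x * y * z)) by (unfold cosine, cosine_sq; field; lra).
  apply Rmult_lt_0_compat.
  - assert (0 < (y + z - x) * (z + x - y) * (x + y - z))
      by (repeat apply Rmult_lt_0_compat; lra).
    assert (0 < x * y * z) by (repeat apply Rmult_lt_0_compat; lra). lra.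
  - apply Rinv_0_lt_compat; repeat apply Rmult_lt_0_compat; lra.
Qed.

(** * Squared distances between points of space *)

Definition sq_distance (A B : point) : R :=
  let '(x1, x2, x3) := A in let '(y1, y2, y3) := B in
  (x1 - y1) ^ 2 + (x2 - y2) ^ 2 + (x3 - y3) ^ 2.

Lemma sq_distance_nonneg A B : 0 <= sq_distance A B.
Proof.
  destruct A as [[a1 a2] a3], B as [[b1 b2] b3]; simpl.
  pose proof (pow2_ge_0 (a1 - b1)); pose proof (pow2_ge_0 (a2 - b2));
    pose proof (pow2_ge_0 (a3 - b3)); simpl in *; lra.
Qed.

Lemma distance_sqrt A B : distance A B = sqrt (sq_distance A B).
Proof. destruct A as [[a1 a2] a3], B as [[b1 b2] b3]; reflexivity. Qed.

Lemma sq_distance_of_distance A B x : distance A B = x -> sq_distance A B = x ^ 2.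
Proof.
  rewrite distance_sqrt; intros <-; symmetry.
  apply pow2_sqrt, sq_distance_nonneg.
Qed.

Lemma sq_distance_sym A B : sq_distance A B = sq_distance B A.
Proof. destruct A as [[a1 a2] a3], B as [[b1 b2] b3]; simpl; ring. Qed.

(** Four vectors in space are linearly dependent, so their Gram determinant vanishes; with
    denominators cleared this is a polynomial identity in coordinates. *)
Lemma gram_of_points (O A1 A2 A3 A4 : point) (l1 l2 l3 l4 m1 m2 m3 m4 : R) :
  0 < l1 -> 0 < l2 -> 0 < l3 -> 0 < l4 ->
  sq_distance O A1 = l1 ^ 2 -> sq_distance O A2 = l2 ^ 2 ->
  sq_distance O A3 = l3 ^ 2 -> sq_distance O A4 = l4 ^ 2 ->
  sq_distance A1 A2 = m1 ^ 2 -> sq_distance A2 A3 = m2 ^ 2 ->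
  sq_distance A3 A4 = m3 ^ 2 -> sq_distance A4 A1 = m4 ^ 2 ->
  gram (cosine l1 l2 m1) (cosine l2 l3 m2) (cosine l3 l4 m3) (cosine l4 l1 m4)
    (cosine_sq l1 l3 (sq_distance A1 A3)) (cosine_sq l2 l4 (sq_distance A2 A4)) = 0.
Proof.
  intros p1 p2 p3 p4 D1 D2 D3 D4 M1 M2 M3 M4.
  unfold cosine; rewrite <- M1, <- M2, <- M3, <- M4; clear M1 M2 M3 M4.
  unfold cosine_sq, gram; rewrite <- D1, <- D2, <- D3, <- D4.
  apply (Rmult_cancel_l (16 * (l1 ^ 2 * l2 ^ 2 * l3 ^ 2 * l4 ^ 2))).
  { apply Rgt_not_eq; repeat apply Rmult_lt_0_compat; try apply pow_lt; lra. }
  rewrite Rmult_0_r.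
  (* Each of these is twice the inner product of two of the vectors from [O]. *)
  set (g12 := sq_distance O A1 + sq_distance O A2 - sq_distance A1 A2).
  set (g23 := sq_distance O A2 + sq_distance O A3 - sq_distance A2 A3).
  set (g34 := sq_distance O A3 + sq_distance O A4 - sq_distance A3 A4).
  set (g41 := sq_distance O A4 + sq_distance O A1 - sq_distance A4 A1).
  set (g13 := sq_distance O A1 + sq_distance O A3 - sq_distance A1 A3).
  set (g24 := sq_distance O A2 + sq_distance O A4 - sq_distance A2 A4).
  transitivity (g13 ^ 2 * g24 ^ 2 - 4 * g13 ^ 2 * (l2 ^ 2 * l4 ^ 2)
    - 4 * g24 ^ 2 * (l1 ^ 2 * l3 ^ 2)
    + 4 * g13 * (g12 * g23 * l4 ^ 2 + g34 * g41 * l2 ^ 2)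
    + 4 * g24 * (g12 * g41 * l3 ^ 2 + g23 * g34 * l1 ^ 2)
    - 2 * g13 * g24 * (g12 * g34 + g23 * g41)
    + 16 * (l1 ^ 2 * l2 ^ 2 * l3 ^ 2 * l4 ^ 2)
    - 4 * (g12 ^ 2 * (l3 ^ 2 * l4 ^ 2) + g23 ^ 2 * (l1 ^ 2 * l4 ^ 2)
       + g34 ^ 2 * (l1 ^ 2 * l2 ^ 2) + g41 ^ 2 * (l2 ^ 2 * l3 ^ 2))
    + (g12 * g34 - g23 * g41) ^ 2).
  { field; lra. }
  rewrite <- D1, <- D2, <- D3, <- D4.
  subst g12 g23 g34 g41 g13 g24; clear.
  destruct O as [[o1 o2] o3], A1 as [[x1 y1] z1], A2 as [[x2 y2] z2],
    A3 as [[x3 y3] z3], A4 as [[x4 y4] z4]; simpl; ring.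
Qed.

(** By Lagrange's identity the product in [H] is minus four times the squared cross product of the
    vectors from [O]. *)
Lemma sq_distance_between (O A C : point) (x y : R) :
  sq_distance O A = x ^ 2 -> sq_distance O C = y ^ 2 -> 0 < x -> 0 < y ->
  (x - y) ^ 2 <= sq_distance A C <= (x + y) ^ 2.
Proof.
  intros D1 D2 px py.
  assert (H : (sq_distance A C - (x + y) ^ 2) * (sq_distance A C - (x - y) ^ 2) <= 0).
  { replace ((sq_distance A C - (x + y) ^ 2) * (sq_distance A C - (x - y) ^ 2))
      with ((x ^ 2 + y ^ 2 - sq_distance A C) ^ 2 - 4 * x ^ 2 * y ^ 2) by ring.
    rewrite <- D1, <- D2; clear.
    destruct O as [[o1 o2] o3], A as [[a1 a2] a3], C as [[c1 c2] c3]; simpl.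
    set (u1 := a1 - o1); set (u2 := a2 - o2); set (u3 := a3 - o3).
    set (w1 := c1 - o1); set (w2 := c2 - o2); set (w3 := c3 - o3).
    match goal with |- ?L <= 0 => replace L with
      (- 4 * ((u1 * w2 - u2 * w1) ^ 2 + (u2 * w3 - u3 * w2) ^ 2
              + (u3 * w1 - u1 * w3) ^ 2)) by (subst u1 u2 u3 w1 w2 w3; ring) end.
    pose proof (pow2_ge_0 (u1 * w2 - u2 * w1)).
    pose proof (pow2_ge_0 (u2 * w3 - u3 * w2)).
    pose proof (pow2_ge_0 (u3 * w1 - u1 * w3)). lra. }
  assert ((x - y) ^ 2 < (x + y) ^ 2) by nra.
  nra.
Qed.

(* The link of [n] is then the cycle [x], [y], [opposite x], [opposite y]. *)
Definition frame (n x y : vertex) : Prop := edge n x /\ edge n y /\ edge x y.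

Lemma opposite_involutive u : opposite (opposite u) = u.
Proof. destruct u; reflexivity. Qed.

Lemma edge_sym u w : edge u w -> edge w u.
Proof. intros [H1 H2]; split; [congruence |]; intros <-; now rewrite opposite_involutive in H2. Qed.

Lemma edge_opposite_l u w : edge u w -> edge (opposite u) w.
Proof. intros [H1 H2]; split; [exact H2 |]; rewrite opposite_involutive; exact H1. Qed.

Lemma edge_opposite_r u w : edge u w -> edge u (opposite w).
Proof. intros H; now apply edge_sym, edge_opposite_l, edge_sym. Qed.

Lemma frame_swap n x y : frame n x y -> frame n y x.
Proof. intros (H1 & H2 & H3); repeat split; try apply edge_sym; auto; try apply H1; try apply H2; now apply edge_sym. Qed.

Lemma frame_opposite_l n x y : frame n x y -> frame (opposite n) x y.
Proof. intros (H1 & H2 & H3); split; [| split]; auto using edge_opposite_l. Qed.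

Lemma frame_rotate n x y : frame n x y -> frame n y (opposite x).
Proof. intros (H1 & H2 & H3); split; [| split]; auto using edge_opposite_r, edge_sym. Qed.

(** A frame is a face read in some order; once the other triples are discarded, one of the six
    orders is found in [faces]. *)
Lemma frame_triangle l n x y : metric_complex l -> frame n x y -> l n x < l n y + l x y.
Proof.
  intros [S _ T] (H1 & H2 & H3).
  assert (Sd : forall u w, u <> w -> opposite u <> w -> l u w = l w u)
    by (intros u w U W; apply S; split; assumption).
  destruct n, x, y;
  try (exfalso; first [now apply (proj1 H1) | now apply (proj2 H1) | now apply (proj1 H2)
    | now apply (proj2 H2) | now apply (proj1 H3) | now apply (proj2 H3)]);
  match goal with |- l ?u ?v < l ?u ?w + l ?v ?w =>
    pose proof (Sd u v ltac:(discriminate) ltac:(discriminate));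
    pose proof (Sd u w ltac:(discriminate) ltac:(discriminate));
    pose proof (Sd v w ltac:(discriminate) ltac:(discriminate));
    first [ pose proof (T u v w ltac:(simpl; tauto)) | pose proof (T v w u ltac:(simpl; tauto))
      | pose proof (T w u v ltac:(simpl; tauto)) | pose proof (T u w v ltac:(simpl; tauto))
      | pose proof (T w v u ltac:(simpl; tauto)) | pose proof (T v u w ltac:(simpl; tauto)) ]
  end; lra.
Qed.

Lemma frame_cosine_bound l n x y :
  metric_complex l -> frame n x y -> -1 < cosine (l n x) (l n y) (l x y) < 1.
Proof.
  intros M F; pose proof F as (H1 & H2 & H3).
  pose proof (frame_triangle l n x y M F).
  pose proof (frame_triangle l n y x M (frame_swap _ _ _ F)).
  assert (F' : frame x y n) by (split; [| split]; auto using edge_sym).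
  pose proof (frame_triangle l x y n M F').
  rewrite (length_sym l M y x) in * by (now apply edge_sym).
  rewrite (length_sym l M x n), (length_sym l M y n) in * by (now apply edge_sym).
  apply cosine_bound; try (apply (length_pos l M); assumption); lra.
Qed.

(** [e = 1] encodes equal opposite angles and [e = -1] supplementary ones. *)
Definition star_III (l : vertex -> vertex -> R) (n x y : vertex) (e : R) : Prop :=
  cosine (l n (opposite x)) (l n (opposite y)) (l (opposite x) (opposite y))
    = e * cosine (l n x) (l n y) (l x y) /\
  cosine (l n (opposite y)) (l n x) (l (opposite y) x)
    = e * cosine (l n y) (l n (opposite x)) (l y (opposite x)).

Lemma acos_eq_iff_sign u w :
  -1 < u < 1 -> -1 < w < 1 ->
  (acos u = acos w <-> w = 1 * u) /\ (acos u = PI - acos w <-> w = -1 * u).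
Proof.
  intros Hu Hw; split; split.
  - intros E; rewrite <- (cos_acos w), <- E, cos_acos; lra.
  - intros ->; f_equal; ring.
  - intros E; rewrite <- (cos_acos w) by lra.
    replace (acos w) with (PI - acos u) by lra.
    rewrite Rtrigo_facts.cos_pi_minus, cos_acos; lra.
  - intros ->; replace (-1 * u) with (- u) by ring; rewrite acos_opp; ring.
Qed.

Lemma angle_class_III_iff l n x y :
  metric_complex l -> frame n x y ->
  (angle_class_III l n (x, y, opposite x, opposite y) <->
   exists e, is_sign e /\ star_III l n x y e).
Proof.
  intros M F1.
  pose proof (frame_rotate _ _ _ F1) as F2.
  pose proof (frame_rotate _ _ _ F2) as F3.
  pose proof (frame_rotate _ _ _ F3) as F4; rewrite opposite_involutive in F4.
  apply (frame_cosine_bound l _ _ _ M) in F1, F2, F3, F4.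
  destruct (acos_eq_iff_sign _ _ F1 F3) as [P1 N1].
  destruct (acos_eq_iff_sign _ _ F2 F4) as [P2 N2].
  change (angle_class_III l n (x, y, opposite x, opposite y)) with
    ((acos (cosine (l n x) (l n y) (l x y)) =
      acos (cosine (l n (opposite x)) (l n (opposite y)) (l (opposite x) (opposite y))) /\
      acos (cosine (l n y) (l n (opposite x)) (l y (opposite x))) =
      acos (cosine (l n (opposite y)) (l n x) (l (opposite y) x))) \/
     (acos (cosine (l n x) (l n y) (l x y)) =
      PI - acos (cosine (l n (opposite x)) (l n (opposite y)) (l (opposite x) (opposite y))) /\
      acos (cosine (l n y) (l n (opposite x)) (l y (opposite x))) =
      PI - acos (cosine (l n (opposite y)) (l n x) (l (opposite y) x)))).
  rewrite P1, N1, P2, N2; unfold star_III; split.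
  - intros [H | H]; [exists 1 | exists (-1)]; (split; [| exact H]);
      [left | right]; reflexivity.
  - intros (e & [-> | ->] & H); [left | right]; exact H.
Qed.

(** * Flexing stars and equators *)

Definition diag (P : R -> vertex -> point) (w : vertex) (t : R) : R :=
  sq_distance (P t w) (P t (opposite w)).

Lemma diag_opposite P w t : diag P (opposite w) t = diag P w t.
Proof. unfold diag; rewrite opposite_involutive; apply sq_distance_sym. Qed.

Lemma hyperbola_opposite_l P w Y x0 y0 k u v :
  hyperbola (diag P w) Y x0 y0 k u v -> hyperbola (diag P (opposite w)) Y x0 y0 k u v.
Proof. intros H t Ht; rewrite diag_opposite; exact (H t Ht). Qed.

Lemma hyperbola_opposite_r P w X x0 y0 k u v :
  hyperbola X (diag P w) x0 y0 k u v -> hyperbola X (diag P (opposite w)) x0 y0 k u v.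
Proof. intros H t Ht; rewrite diag_opposite; exact (H t Ht). Qed.

Definition flex_on (l : vertex -> vertex -> R) (P : R -> vertex -> point)
    (u v : R) : Prop :=
  u < v /\ (forall t, u < t < v -> isometric_realization l (P t)) /\
  (forall w, flexing (diag P w) u v).

Lemma flex_on_sub l P u v u' v' :
  subinterval u' v' u v -> flex_on l P u v -> flex_on l P u' v'.
Proof.
  intros S (Huv & HR & HF); pose proof S as (S1 & S2 & S3).
  split; [exact S2 | split].
  - intros t Ht; apply HR; lra.
  - intros w; apply (flexing_sub _ u v); auto.
Qed.

Lemma subinterval_trans u v u' v' u'' v'' :
  subinterval u'' v'' u' v' -> subinterval u' v' u v -> subinterval u'' v'' u v.
Proof. unfold subinterval; lra. Qed.

Lemma sq_distance_coordinates (A B : point) :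
  sq_distance A B =
  (fst (fst A) - fst (fst B)) * (fst (fst A) - fst (fst B))
  + (snd (fst A) - snd (fst B)) * (snd (fst A) - snd (fst B))
  + (snd A - snd B) * (snd A - snd B).
Proof. destruct A as [[a1 a2] a3], B as [[b1 b2] b3]; simpl; ring. Qed.

Lemma continuity_pt_sq_distance (f g : R -> point) (t : R) :
  continuous f t -> continuous g t ->
  continuity_pt (fun t => sq_distance (f t) (g t)) t.
Proof.
  intros Cf Cg.
  apply continuity_pt_filterlim.
  apply (continuous_ext (fun t =>
    (fst (fst (f t)) - fst (fst (g t))) * (fst (fst (f t)) - fst (fst (g t)))
    + (snd (fst (f t)) - snd (fst (g t))) * (snd (fst (f t)) - snd (fst (g t)))
    + (snd (f t) - snd (g t)) * (snd (f t) - snd (g t)))).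
  { intros x; symmetry; apply sq_distance_coordinates. }
  assert (C1 : forall f : R -> point, continuous f t -> continuous (fun t => fst (fst (f t))) t)
    by (intros k Ck; apply (continuous_comp (fun t => fst (k t)) fst);
        [apply (continuous_comp k fst); [exact Ck | apply continuous_fst] | apply continuous_fst]).
  assert (C2 : forall f : R -> point, continuous f t -> continuous (fun t => snd (fst (f t))) t)
    by (intros k Ck; apply (continuous_comp (fun t => fst (k t)) snd);
        [apply (continuous_comp k fst); [exact Ck | apply continuous_fst] | apply continuous_snd]).
  assert (C3 : forall f : R -> point, continuous f t -> continuous (fun t => snd (f t)) t)
    by (intros k Ck; apply (continuous_comp k snd); [exact Ck | apply continuous_snd]).
  assert (CM : forall a b : R -> R, continuous a t -> continuous b t ->
    continuous (fun t => (a t - b t) * (a t - b t)) t).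
  { intros a b Ca Cb.
    apply (continuous_mult (fun t => a t - b t) (fun t => a t - b t));
      apply (continuous_minus a b); assumption. }
  apply (continuous_plus (fun t => (fst (fst (f t)) - fst (fst (g t))) * (fst (fst (f t)) - fst (fst (g t)))
    + (snd (fst (f t)) - snd (fst (g t))) * (snd (fst (f t)) - snd (fst (g t))))).
  - apply (continuous_plus (fun t => (fst (fst (f t)) - fst (fst (g t))) * (fst (fst (f t)) - fst (fst (g t))))).
    + apply (CM (fun t => fst (fst (f t))) (fun t => fst (fst (g t)))); auto.
    + apply (CM (fun t => snd (fst (f t))) (fun t => snd (fst (g t)))); auto.
  - apply (CM (fun t => snd (f t)) (fun t => snd (g t))); auto.
Qed.

(** Strictly between two points of the interval, continuity on it is ordinary continuity; a constant
    squared diagonal would make the diagonal constant. *)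
Lemma flex_on_of_realizable l :
  realizable_as_nontrivially_flexible l -> exists P u v, flex_on l P u v.
Proof.
  intros (I & P & [Iconv (x & y & Ix & Iy & Hxy)] & (HC & HR & HN)).
  assert (Hin : forall t, x <= t <= y -> I t) by (intros t; exact (Iconv x y t Ix Iy)).
  exists P, x, y; split; [exact Hxy | split].
  - intros t Ht; apply HR, Hin; lra.
  - intros w; split.
    + intros t Ht.
      assert (L : locally t I).
      { assert (Hpos : 0 < Rmin (t - x) (y - t)) by (apply Rmin_glb_lt; lra).
        exists (mkposreal _ Hpos); intros z Hz; apply Hin.
        change (Rabs (z - t) < Rmin (t - x) (y - t)) in Hz.
        pose proof (Rmin_l (t - x) (y - t)); pose proof (Rmin_r (t - x) (y - t)).
        apply Rabs_def2 in Hz; lra. }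
      apply (continuity_pt_sq_distance (fun t => P t w) (fun t => P t (opposite w)));
        apply (continuous_continuous_on I); auto.
    + intros x' y' H1 H2 H3 [k Hk].
      apply (HN w x' y'); [apply Hin; lra | apply Hin; lra | exact H2 |].
      exists (sqrt k); intros t Ht; rewrite distance_sqrt; f_equal; exact (Hk t Ht).
Qed.

Lemma star_gram l P u v n x y t :
  metric_complex l -> flex_on l P u v -> frame n x y -> u < t < v ->
  gram (cosine (l n x) (l n y) (l x y))
    (cosine (l n y) (l n (opposite x)) (l y (opposite x)))
    (cosine (l n (opposite x)) (l n (opposite y)) (l (opposite x) (opposite y)))
    (cosine (l n (opposite y)) (l n x) (l (opposite y) x))
    (cosine_sq (l n x) (l n (opposite x)) (diag P x t))
    (cosine_sq (l n y) (l n (opposite y)) (diag P y t)) = 0.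
Proof.
  intros M (_ & HR & _) (H1 & H2 & H3) Ht.
  assert (D : forall a b, edge a b -> sq_distance (P t a) (P t b) = l a b ^ 2)
    by (intros a b E; apply sq_distance_of_distance, HR; assumption).
  apply (gram_of_points (P t n));
    first [apply (length_pos l M) | apply D];
    auto using edge_opposite_l, edge_opposite_r, edge_sym.
Qed.

Lemma cosine_sq_affine x y z2 :
  0 < x -> 0 < y ->
  cosine_sq x y z2 = (x ^ 2 + y ^ 2) / (2 * x * y) + - / (2 * x * y) * z2.
Proof. intros px py; unfold cosine_sq; field; lra. Qed.

Lemma flexing_cosine_sq x y X u v :
  0 < x -> 0 < y -> flexing X u v -> flexing (fun t => cosine_sq x y (X t)) u v.
Proof.
  intros px py F.
  assert (N : - / (2 * x * y) <> 0) by (apply Ropp_neq_0_compat, Rinv_neq_0_compat; nra).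
  destruct (flexing_affine X u v ((x ^ 2 + y ^ 2) / (2 * x * y)) _ N F) as [C K]; split.
  - intros t Ht; apply (continuity_pt_ext
      (fun t => (x ^ 2 + y ^ 2) / (2 * x * y) + - / (2 * x * y) * X t)); [| auto].
    intros s; symmetry; apply cosine_sq_affine; assumption.
  - intros a b Ha Hab Hb [k Hk]; apply (K a b Ha Hab Hb); exists k.
    intros t Ht; rewrite <- cosine_sq_affine by assumption; auto.
Qed.

(** The Gram determinant factors, and one factor vanishes on a subinterval; the constant of that
    hyperbola is a positive multiple of [e * C ^ 2]. *)
Lemma star_hyperbola l P u v n x y e :
  metric_complex l -> flex_on l P u v -> frame n x y ->
  is_sign e -> star_III l n x y e ->
  exists u' v' si k, subinterval u' v' u v /\ is_sign si /\ 0 < e * k /\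
    hyperbola (diag P x) (diag P y) ((l n x + si * l n (opposite x)) ^ 2)
      ((l n y + e * si * l n (opposite y)) ^ 2) k u' v'.
Proof.
  intros M Fl Fr He [S1 S2].
  pose proof (fun t => star_gram l P u v n x y t M Fl Fr) as G.
  rewrite S1, S2 in G.
  destruct Fr as (H1 & H2 & _).
  pose proof (length_pos l M _ _ H1) as p1.
  pose proof (length_pos l M _ _ H2) as p2.
  pose proof (length_pos l M _ _ (edge_opposite_r _ _ H1)) as p3.
  pose proof (length_pos l M _ _ (edge_opposite_r _ _ H2)) as p4.
  set (l1 := l n x) in *; set (l2 := l n y) in *.
  set (l3 := l n (opposite x)) in *; set (l4 := l n (opposite y)) in *.
  set (C1 := cosine l1 l2 (l x y)) in *.
  set (C2 := cosine l2 l3 (l y (opposite x))) in *.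
  pose proof Fl as (Huv & _ & FF).
  pose proof (proj1 (flexing_cosine_sq l1 l3 _ _ _ p1 p3 (FF x))) as CX.
  pose proof (proj1 (flexing_cosine_sq l2 l4 _ _ _ p2 p4 (FF y))) as CY.
  set (X := fun t => cosine_sq l1 l3 (diag P x t)) in CX.
  set (Y := fun t => cosine_sq l2 l4 (diag P y t)) in CY.
  assert (PP : 0 < 4 * l1 * l2 * l3 * l4) by (repeat apply Rmult_lt_0_compat; lra).
  (* Both factors are covered: [si = 1] with [C = C1 + C2], and [si = -1] with [C = C1 - C2]. *)
  assert (Key : forall u' v' si C, subinterval u' v' u v -> is_sign si ->
    (forall t, u' < t < v' -> (X t + si) * (Y t + e * si) - e * C ^ 2 = 0) ->
    exists u' v' si k, subinterval u' v' u v /\ is_sign si /\ 0 < e * k /\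
    hyperbola (diag P x) (diag P y) ((l1 + si * l3) ^ 2)
      ((l2 + e * si * l4) ^ 2) k u' v').
  { intros u' v' si C S Hsi Z.
    set (k := 4 * l1 * l2 * l3 * l4 * (e * C ^ 2)).
    assert (H : hyperbola (diag P x) (diag P y) ((l1 + si * l3) ^ 2)
      ((l2 + e * si * l4) ^ 2) k u' v').
    { intros t Ht.
      rewrite (cosine_sq_shift l1 l3), (cosine_sq_shift l2 l4); try assumption.
      - fold (X t); fold (Y t); unfold k.
        replace (e * C ^ 2) with ((X t + si) * (Y t + e * si)) by (specialize (Z t Ht); lra).
        ring.
      - destruct He as [-> | ->], Hsi as [-> | ->]; unfold is_sign; lra. }
    exists u', v', si, k; repeat split; auto; try apply S.
    pose proof (flex_on_sub _ _ _ _ _ _ S Fl) as (Huv' & _ & FF').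
    pose proof (hyperbola_nonzero _ _ _ _ _ _ _ Huv' (FF' x) (FF' y) H) as K.
    replace (e * k) with (4 * l1 * l2 * l3 * l4 * C ^ 2)
      by (unfold k; destruct He as [-> | ->]; ring).
    apply Rmult_lt_0_compat; [exact PP |]; apply pow2_gt_0; intros ->.
    apply K; unfold k; ring. }
  destruct (product_zero_split (fun t => (X t + 1) * (Y t + e) - e * (C1 + C2) ^ 2)
    (fun t => (X t - 1) * (Y t - e) - e * (C1 - C2) ^ 2) u v Huv)
    as (u' & v' & S & [Z | Z]).
  - intros t Ht.
    assert (Ct : forall c : R, continuity_pt (fun _ => c) t)
      by (intros c; apply continuity_pt_const; intros ? ?; reflexivity).
    apply continuity_pt_minus; [| apply Ct].
    apply continuity_pt_mult; apply continuity_pt_plus; auto.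
  - intros t Ht; cbv beta; rewrite <- gram_factorization by exact He; apply G, Ht.
  - apply (Key u' v' 1 (C1 + C2) S); [left; reflexivity |].
    intros t Ht; specialize (Z t Ht); cbv beta in Z; rewrite Rmult_1_r; exact Z.
  - apply (Key u' v' (-1) (C1 - C2) S); [right; reflexivity |].
    intros t Ht; specialize (Z t Ht); cbv beta in Z.
    replace (e * -1) with (- e) by ring; exact Z.
Qed.

(** * The common hyperbola of the two stars of an equator *)

(** [ef_x] and [ef_y] equate the centres found at the two poles; they yield the zero sums of the
    other two equators. *)
Record equator_flex (l : vertex -> vertex -> R) (P : R -> vertex -> point)
    (n x y : vertex) (u v si ta k : R) : Prop := {
  ef_si : is_sign si;
  ef_ta : is_sign ta;
  ef_k : 0 < si * ta * k;
  ef_star : star_III l n x y (si * ta);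
  ef_star' : star_III l (opposite n) x y (si * ta);
  ef_x : (l n x + si * l n (opposite x)) ^ 2
         = (l (opposite n) x + si * l (opposite n) (opposite x)) ^ 2;
  ef_y : (l n y + ta * l n (opposite y)) ^ 2
         = (l (opposite n) y + ta * l (opposite n) (opposite y)) ^ 2;
  ef_hyp : hyperbola (diag P x) (diag P y) ((l n x + si * l n (opposite x)) ^ 2)
             ((l n y + ta * l n (opposite y)) ^ 2) k u v
}.

Lemma equator_flex_sub l P n x y u v si ta k u' v' :
  subinterval u' v' u v -> equator_flex l P n x y u v si ta k ->
  equator_flex l P n x y u' v' si ta k.
Proof.
  intros S []; constructor; try assumption; eapply hyperbola_sub; eassumption.
Qed.

(* If the sum of two sides at one pole were the difference of the two sides at
   the other, the diagonal would be squeezed to a constant. *)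
Lemma pole_signs_agree l P u v n x si si' :
  metric_complex l -> flex_on l P u v -> edge n x -> is_sign si -> is_sign si' ->
  (l n x + si * l n (opposite x)) ^ 2
    = (l (opposite n) x + si' * l (opposite n) (opposite x)) ^ 2 ->
  si = si'.
Proof.
  intros M (Huv & HR & FF) E1 Hs Hs' Eq.
  assert (E2 := edge_opposite_r _ _ E1).
  assert (E3 := edge_opposite_l _ _ E1).
  assert (E4 := edge_opposite_l _ _ E2).
  assert (Bd : forall m t, u < t < v -> edge m x -> edge m (opposite x) ->
    (l m x - l m (opposite x)) ^ 2 <= diag P x t <= (l m x + l m (opposite x)) ^ 2).
  { intros m t Ht F1 F2; apply (sq_distance_between (P t m));
      try (apply (length_pos l M); assumption);
      apply sq_distance_of_distance, HR; assumption. }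
  destruct Hs as [-> | ->], Hs' as [-> | ->]; try reflexivity; exfalso.
  - apply (flexing_not_constant (diag P x) u v ((l n x + l n (opposite x)) ^ 2) Huv (FF x)).
    intros t Ht; pose proof (Bd n t Ht E1 E2); pose proof (Bd (opposite n) t Ht E3 E4).
    apply Rle_antisym; lra.
  - apply (flexing_not_constant (diag P x) u v ((l n x - l n (opposite x)) ^ 2) Huv (FF x)).
    intros t Ht; pose proof (Bd n t Ht E1 E2); pose proof (Bd (opposite n) t Ht E3 E4).
    apply Rle_antisym; lra.
Qed.

(** On a common subinterval both stars give a hyperbola between the same diagonals, and
    [hyperbola_unique] identifies the two. *)
Lemma equator_flex_exists l P u v n x y :
  metric_complex l -> flex_on l P u v -> frame n x y ->
  (exists e, is_sign e /\ star_III l n x y e) ->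
  (exists e, is_sign e /\ star_III l (opposite n) x y e) ->
  exists u' v' si ta k, subinterval u' v' u v /\
    equator_flex l P n x y u' v' si ta k.
Proof.
  intros M Fl Fr (e & He & S) (e' & He' & S').
  destruct (star_hyperbola l P u v n x y e M Fl Fr He S)
    as (u1 & v1 & si & k & I1 & Hsi & Hk & H1).
  pose proof (flex_on_sub _ _ _ _ _ _ I1 Fl) as Fl1.
  destruct (star_hyperbola l P u1 v1 _ x y e' M Fl1 (frame_opposite_l _ _ _ Fr) He' S')
    as (u2 & v2 & si' & k' & I2 & Hsi' & Hk' & H2).
  pose proof (flex_on_sub _ _ _ _ _ _ I2 Fl1) as Fl2.
  apply (hyperbola_sub _ _ _ _ _ _ _ _ _ I2) in H1.
  pose proof Fl2 as (Huv & _ & FF).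
  destruct (hyperbola_unique _ _ _ _ _ _ _ _ _ _ Huv (FF x) (FF y) H1 H2) as (EX & EY & EK).
  subst k'.
  (* Both signs are that of the common constant [k]. *)
  assert (e = e').
  { clear - He He' Hk Hk'; destruct He as [-> | ->], He' as [-> | ->]; lra. }
  subst e'.
  assert (si = si')
    by (apply (pole_signs_agree l P u2 v2 n x si si' M Fl2 (proj1 Fr) Hsi Hsi' EX)).
  subst si'.
  assert (HH : is_sign (e * si) /\ si * (e * si) = e)
    by (clear - He Hsi; unfold is_sign; destruct He as [-> | ->], Hsi as [-> | ->]; lra).
  destruct HH as [Hta Hp].
  exists u2, v2, si, (e * si), k; split.
  - eapply subinterval_trans; eassumption.
  - constructor; try assumption; rewrite Hp; assumption.
Qed.

(** Eliminating the shared diagonal leaves an affine relation, excluded by [gram_not_linear], or a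
    hyperbola, from which [gram_hyperbola] gives class III. *)
Lemma third_star_III l P u v n x y z x1 y1 k1 x3 z3 k3 :
  metric_complex l -> flex_on l P u v -> frame n y z ->
  hyperbola (diag P x) (diag P y) x1 y1 k1 u v ->
  hyperbola (diag P x) (diag P z) x3 z3 k3 u v ->
  exists e, is_sign e /\ star_III l n y z e.
Proof.
  intros M Fl Fr H1 H3.
  pose proof (fun t => star_gram l P u v n y z t M Fl Fr) as G.
  pose proof (frame_cosine_bound l _ _ _ M Fr) as B1.
  pose proof (frame_cosine_bound l _ _ _ M (frame_rotate _ _ _ Fr)) as B2.
  pose proof Fr as (E1 & E2 & _).
  pose proof (length_pos l M _ _ E1) as p1.
  pose proof (length_pos l M _ _ E2) as p2.
  pose proof (length_pos l M _ _ (edge_opposite_r _ _ E1)) as p3.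
  pose proof (length_pos l M _ _ (edge_opposite_r _ _ E2)) as p4.
  unfold star_III.
  set (l1 := l n y) in *; set (l2 := l n z) in *.
  set (l3 := l n (opposite y)) in *; set (l4 := l n (opposite z)) in *.
  pose proof Fl as (Huv & _ & FF).
  pose proof (hyperbola_nonzero _ _ _ _ _ _ _ Huv (FF x) (FF y) H1) as K1.
  pose proof (hyperbola_nonzero _ _ _ _ _ _ _ Huv (FF x) (FF z) H3) as K3.
  pose proof (flexing_cosine_sq l1 l3 _ _ _ p1 p3 (FF y)) as FY.
  pose proof (flexing_cosine_sq l2 l4 _ _ _ p2 p4 (FF z)) as FZ.
  destruct (hyperbola_eliminate _ _ _ _ _ _ _ _ _ _ _ Huv (FF x) (FF y) (FF z) H1 H3)
    as [L | [_ H]].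
  - exfalso.
    refine (gram_not_linear _ _ _ _ _ _
      ((l1 ^ 2 + l3 ^ 2 - y1 - k1 / k3 * (l2 ^ 2 + l4 ^ 2 - z3)) / (2 * l1 * l3))
      (k1 / k3 * (2 * l2 * l4) / (2 * l1 * l3)) u v Huv FZ _ _ G).
    + unfold Rdiv; repeat apply Rmult_integral_contrapositive_currified; try lra;
        apply Rinv_neq_0_compat; nra.
    + intros t Ht; unfold cosine_sq.
      replace (diag P y t) with (y1 + k1 / k3 * (diag P z t - z3))
        by (apply (Rmult_cancel_l k3); [exact K3 |];
            transitivity (k3 * y1 + k1 * (diag P z t - z3));
            [field; exact K3 | rewrite <- (L t Ht); ring]).
      field; repeat split; lra.
  - eapply gram_hyperbola with (X0 := cosine_sq l1 l3 (y1 - k1 / (x1 - x3)))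
      (Y0 := cosine_sq l2 l4 (z3 + k3 / (x1 - x3)));
      [exact Huv | exact FY | exact FZ | nra | nra | | exact G].
    intros t Ht; cbv beta.
    (* The cosines are affine in the squared diagonals, so the hyperbola persists with a rescaled
       constant. *)
    transitivity ((diag P y t - (y1 - k1 / (x1 - x3))) * (diag P z t - (z3 + k3 / (x1 - x3)))
       * / (2 * l1 * l3) * / (2 * l2 * l4)).
    + unfold cosine_sq; generalize (k1 / (x1 - x3)), (k3 / (x1 - x3)); intros; field; lra.
    + rewrite (H t Ht); reflexivity.
Qed.

(** * The twelve edge lengths *)

Lemma cosine_eq_cross x y z x' y' z' e :
  0 < x -> 0 < y -> 0 < x' -> 0 < y' ->
  cosine x y z = e * cosine x' y' z' ->
  (x ^ 2 + y ^ 2 - z ^ 2) * (x' * y') = e * (x' ^ 2 + y' ^ 2 - z' ^ 2) * (x * y).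
Proof.
  intros px py px' py' E.
  transitivity (cosine x y z * (2 * x * y * (x' * y')));
    [| rewrite E]; unfold cosine, cosine_sq; field; lra.
Qed.

(* 16 times the squared area of the triangle. *)
Definition heron (x y z : R) : R :=
  4 * x ^ 2 * y ^ 2 - (x ^ 2 + y ^ 2 - z ^ 2) ^ 2.

Lemma heron_pos x y z :
  0 < x -> 0 < y -> 0 < z -> z < x + y -> x < z + y -> y < z + x -> 0 < heron x y z.
Proof.
  intros; replace (heron x y z)
    with ((x + y + z) * (x + y - z) * (z + y - x) * (z + x - y)) by (unfold heron; ring).
  repeat apply Rmult_lt_0_compat; lra.
Qed.

(** The squared sine of the angle is [heron x y z / (2 * x * y) ^ 2], and a sign on the cosine does
    not change it. *)
Lemma heron_of_cosine_eq x y z x' y' z' e :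
  0 < x -> 0 < y -> 0 < x' -> 0 < y' -> is_sign e ->
  cosine x y z = e * cosine x' y' z' ->
  heron x y z * (x' * y') ^ 2 = heron x' y' z' * (x * y) ^ 2.
Proof.
  intros px py px' py' He E.
  apply cosine_eq_cross in E; try assumption.
  unfold heron.
  transitivity (4 * (x * y * (x' * y')) ^ 2
    - ((x ^ 2 + y ^ 2 - z ^ 2) * (x' * y')) ^ 2); [ring |].
  rewrite E; destruct He as [-> | ->]; ring.
Qed.

Lemma ratio_cycle (H1 H2 H3 A1 A2 A3 B1 B2 B3 : R) :
  0 < H1 -> 0 < H2 -> 0 < H3 -> 0 < A1 -> 0 < A2 -> 0 < A3 ->
  0 < B1 -> 0 < B2 -> 0 < B3 ->
  H2 * A1 ^ 2 = H1 * B1 ^ 2 -> H3 * A2 ^ 2 = H2 * B2 ^ 2 ->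
  H1 * A3 ^ 2 = H3 * B3 ^ 2 -> A1 * A2 * A3 = B1 * B2 * B3.
Proof.
  intros h1 h2 h3 a1 a2 a3 b1 b2 b3 E1 E2 E3.
  assert (E : (A1 * A2 * A3) ^ 2 = (B1 * B2 * B3) ^ 2).
  { apply (Rmult_cancel_l (H1 * H2 * H3));
      [apply Rgt_not_eq; repeat apply Rmult_lt_0_compat; assumption |].
    transitivity ((H2 * A1 ^ 2) * (H3 * A2 ^ 2) * (H1 * A3 ^ 2)); [ring |].
    rewrite E1, E2, E3; ring. }
  assert (0 < A1 * A2 * A3) by (repeat apply Rmult_lt_0_compat; assumption).
  assert (0 < B1 * B2 * B3) by (repeat apply Rmult_lt_0_compat; assumption).
  destruct (sign_of_sqr_eq _ _ E) as (e & [-> | ->] & Ee); lra.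
Qed.

(** Taking square roots leaves four sign cases: one contradicts positivity, and each other
    annihilates one factor. *)
Lemma zero_sum4_of_sqr l1 l2 l3 l4 e :
  0 < l1 -> 0 < l2 -> 0 < l3 -> 0 < l4 -> is_sign e ->
  (l2 + e * l3) ^ 2 = (l1 + e * l4) ^ 2 -> zero_sum4 l1 l2 l3 l4.
Proof.
  intros p1 p2 p3 p4 He E; unfold zero_sum4.
  destruct (sign_of_sqr_eq _ _ E) as (t & Ht & E').
  destruct He as [-> | ->], Ht as [-> | ->];
    [ replace (l1 - l2 - l3 + l4) with 0 by lra | exfalso; lra
    | replace (l1 - l2 + l3 - l4) with 0 by lra
    | replace (l1 + l2 - l3 - l4) with 0 by lra ]; ring.
Qed.

Lemma cosine_comm x y z : cosine x y z = cosine y x z.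
Proof. unfold cosine, cosine_sq; f_equal; ring. Qed.

Definition triangle (x y z : R) : Prop :=
  0 < x /\ 0 < y /\ 0 < z /\ z < x + y /\ x < z + y /\ y < z + x.

(** * From two equators of class III to all three *)

(** The cycle is then [x], [y], [opposite x], [opposite y], and the second pole is [opposite n]. *)
Definition frame_of (E : equator) : vertex * vertex * vertex :=
  match E with
  | E2345 => (v1, v2, v3) | E6214 => (v3, v6, v2) | E5136 => (v2, v5, v1)
  end.

Lemma class_III_iff l E :
  metric_complex l ->
  let '(n, x, y) := frame_of E in
  class_III l E <->
  (exists e, is_sign e /\ star_III l n x y e) /\
  (exists e, is_sign e /\ star_III l (opposite n) x y e).
Proof.
  intros M.
  assert (F : let '(n, x, y) := frame_of E in frame n x y)
    by (destruct E; repeat split; discriminate).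
  destruct E; simpl in F |- *;
    rewrite <- (angle_class_III_iff l _ _ _ M F),
      <- (angle_class_III_iff l _ _ _ M (frame_opposite_l _ _ _ F)); reflexivity.
Qed.

(** Two equators share one diagonal, which joins the poles of the third; eliminating it reaches the
    third equator. *)
Lemma class_III_of_two l :
  metric_complex l -> realizable_as_nontrivially_flexible l ->
  (class_III l E2345 /\ class_III l E6214) \/
  (class_III l E2345 /\ class_III l E5136) \/
  (class_III l E6214 /\ class_III l E5136) ->
  forall E, class_III l E.
Proof.
  intros M HF H.
  destruct (flex_on_of_realizable l HF) as (P & u0 & v0 & Fl0).
  assert (FA : frame v1 v2 v3) by (repeat split; discriminate).
  assert (FB : frame v3 v6 v2) by (repeat split; discriminate).
  assert (FC : frame v2 v5 v1) by (repeat split; discriminate).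
  pose proof (class_III_iff l E2345 M) as IA; pose proof (class_III_iff l E6214 M) as IB;
    pose proof (class_III_iff l E5136 M) as IC; simpl frame_of in IA, IB, IC; cbv iota in IA, IB, IC.
  assert (Two : forall n x y m z w, frame n x y -> frame m z w ->
    (exists e, is_sign e /\ star_III l n x y e) ->
    (exists e, is_sign e /\ star_III l (opposite n) x y e) ->
    (exists e, is_sign e /\ star_III l m z w e) ->
    (exists e, is_sign e /\ star_III l (opposite m) z w e) ->
    exists u v x1 y1 k1 x2 y2 k2, flex_on l P u v /\
      hyperbola (diag P x) (diag P y) x1 y1 k1 u v /\
      hyperbola (diag P z) (diag P w) x2 y2 k2 u v).
  { intros n x y m z w F1 F2 S1 S1' S2 S2'.
    destruct (equator_flex_exists l P u0 v0 n x y M Fl0 F1 S1 S1')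
      as (u & v & si & ta & k & I & D1).
    pose proof (flex_on_sub _ _ _ _ _ _ I Fl0) as Fl.
    destruct (equator_flex_exists l P u v m z w M Fl F2 S2 S2')
      as (u' & v' & si' & ta' & k' & I' & D2).
    exists u', v'; do 6 eexists; split; [exact (flex_on_sub _ _ _ _ _ _ I' Fl) |].
    split; [| exact (ef_hyp _ _ _ _ _ _ _ _ _ _ D2)].
    exact (hyperbola_sub _ _ _ _ _ _ _ _ _ I' (ef_hyp _ _ _ _ _ _ _ _ _ _ D1)). }
  destruct H as [[CA CB] | [[CA CC] | [CB CC]]].
  - pose proof (proj1 IA CA) as [A1 A2]; pose proof (proj1 IB CB) as [B1 B2].
    destruct (Two _ _ _ _ _ _ FA FB A1 A2 B1 B2)
      as (u & v & x1 & y1 & k1 & x2 & y2 & k2 & Fl & H1 & H2).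
    (* Opposite vertices name the same diagonal; both hyperbolas are rewritten with the shared
       diagonal first. *)
    apply (hyperbola_opposite_r P v3) in H1.
    apply (hyperbola_opposite_l P v6), hyperbola_sym in H2.
    intros []; [exact CA | exact CB | apply IC; split];
      (eapply third_star_III; [exact M | exact Fl | | exact H1 | exact H2]);
      [exact FC | exact (frame_opposite_l _ _ _ FC)].
  - pose proof (proj1 IA CA) as [A1 A2]; pose proof (proj1 IC CC) as [B1 B2].
    destruct (Two _ _ _ _ _ _ FA FC A1 A2 B1 B2)
      as (u & v & x1 & y1 & k1 & x2 & y2 & k2 & Fl & H1 & H2).
    apply hyperbola_sym in H1.
    apply (hyperbola_opposite_l P v5), (hyperbola_opposite_r P v1) in H2.
    intros []; [exact CA | apply IB; split | exact CC];
      (eapply third_star_III; [exact M | exact Fl | | exact H2 | exact H1]);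
      [exact FB | exact (frame_opposite_l _ _ _ FB)].
  - pose proof (proj1 IB CB) as [A1 A2]; pose proof (proj1 IC CC) as [B1 B2].
    destruct (Two _ _ _ _ _ _ FB FC A1 A2 B1 B2)
      as (u & v & x1 & y1 & k1 & x2 & y2 & k2 & Fl & H1 & H2).
    apply hyperbola_sym, (hyperbola_opposite_l P v1), (hyperbola_opposite_r P v5) in H2.
    intros []; [apply IA; split | exact CB | exact CC];
      (eapply third_star_III; [exact M | exact Fl | | exact H1 | exact H2]);
      [exact FA | exact (frame_opposite_l _ _ _ FA)].
Qed.

(** * Product relations, signs of the equators and the factors [B] *)

(** Any two of the three faces have equal sines at their common vertex; multiplying the three
    equalities cancels the areas. *)
Lemma opposite_faces_relation (x1 x2 x3 y1 y2 y3 z1 z2 z3 : R) :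
  triangle x1 x2 x3 -> triangle y1 y2 y3 -> triangle z1 z2 z3 ->
  heron y1 y2 y3 * (x1 * x2) ^ 2 = heron x1 x2 x3 * (y1 * y2) ^ 2 ->
  heron z1 z2 z3 * (y2 * y3) ^ 2 = heron y1 y2 y3 * (z2 * z3) ^ 2 ->
  heron x1 x2 x3 * (z1 * z3) ^ 2 = heron z1 z2 z3 * (x1 * x3) ^ 2 ->
  x2 * y3 * z1 = x3 * y1 * z2.
Proof.
  intros (a1 & a2 & a3 & a4 & a5 & a6) (b1 & b2 & b3 & b4 & b5 & b6)
    (c1 & c2 & c3 & c4 & c5 & c6) E1 E2 E3.
  assert (F : (x1 * x2) * (y2 * y3) * (z1 * z3) = (y1 * y2) * (z2 * z3) * (x1 * x3)).
  { apply (ratio_cycle (heron x1 x2 x3) (heron y1 y2 y3) (heron z1 z2 z3));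
      try (apply heron_pos; assumption); try (apply Rmult_lt_0_compat; assumption);
      assumption. }
  apply (Rmult_cancel_l (x1 * y2 * z3));
    [apply Rgt_not_eq; repeat apply Rmult_lt_0_compat; assumption | lra].
Qed.

Lemma symmetric4_half_turn l1 l2 l3 l4 :
  symmetric4 l1 l2 l3 l4 -> symmetric4 l3 l4 l1 l2.
Proof.
  intros [[<- <-] | [[<- <-] | [<- <-]]]; unfold symmetric4; auto.
Qed.

Lemma is_sign_mult e1 e2 : is_sign e1 -> is_sign e2 -> is_sign (e1 * e2).
Proof. unfold is_sign; intros [-> | ->] [-> | ->]; lra. Qed.

(** The six relations pair off the twelve angles of four faces, so their cosines sum to zero, while
    each face contributes a positive sum. *)
Lemma cosine_sum_four_faces (a b c d e f g h p q r s : R) :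
  triangle p q c -> triangle r s h -> triangle d g b -> triangle a e f ->
  cosine r s h = -1 * cosine p q c -> cosine d b g = -1 * cosine a e f ->
  cosine f a e = -1 * cosine c q p -> cosine s h r = -1 * cosine d g b ->
  cosine b g d = -1 * cosine p c q -> cosine f e a = -1 * cosine h r s -> False.
Proof.
  intros (? & ? & ? & ? & ? & ?) (? & ? & ? & ? & ? & ?) (? & ? & ? & ? & ? & ?)
    (? & ? & ? & ? & ? & ?) C1 C6 C3 C5 C2 C4.
  pose proof (cosine_sum_pos p q c ltac:(lra) ltac:(lra) ltac:(lra) ltac:(lra) ltac:(lra) ltac:(lra)).
  pose proof (cosine_sum_pos r s h ltac:(lra) ltac:(lra) ltac:(lra) ltac:(lra) ltac:(lra) ltac:(lra)).
  pose proof (cosine_sum_pos d g b ltac:(lra) ltac:(lra) ltac:(lra) ltac:(lra) ltac:(lra) ltac:(lra)).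
  pose proof (cosine_sum_pos a e f ltac:(lra) ltac:(lra) ltac:(lra) ltac:(lra) ltac:(lra) ltac:(lra)).
  rewrite (cosine_comm d b g), (cosine_comm b g d), (cosine_comm f e a) in *.
  rewrite (cosine_comm c q p), (cosine_comm p c q) in *.
  lra.
Qed.

(* The cases [si2 * ta2 = -1] and [si3 * ta3 = -1] are reduced to [si1 * ta1 = -1]
   by the rotations about the axis through the faces [v1 v4 v5] and [v6 v2 v3],
   which permute the four factors [B]. *)
Lemma symmetric_or_B_product_zero (a b c d e f g h p q r s : R)
    (si1 ta1 si2 ta2 si3 ta3 : R) :
  triangle p q c -> triangle r s h -> triangle d g b -> triangle a e f ->
  is_sign si1 -> is_sign ta1 -> is_sign si2 -> is_sign ta2 ->
  is_sign si3 -> is_sign ta3 ->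
  (si1 * ta1) * (si2 * ta2) * (si3 * ta3) < 0 ->
  cosine r s h = si1 * ta1 * cosine p q c ->
  cosine d b g = si1 * ta1 * cosine a e f ->
  cosine f a e = si2 * ta2 * cosine c q p ->
  cosine s h r = si2 * ta2 * cosine d g b ->
  cosine b g d = si3 * ta3 * cosine p c q ->
  cosine f e a = si3 * ta3 * cosine h r s ->
  cosine e d h = si1 * ta1 * cosine b a c ->
  cosine q f r = si2 * ta2 * cosine a c b ->
  cosine c b a = si3 * ta3 * cosine g p s ->
  (p + si1 * r) ^ 2 = (b + si1 * e) ^ 2 -> (q + ta1 * s) ^ 2 = (a + ta1 * d) ^ 2 ->
  (a + si2 * q) ^ 2 = (d + si2 * s) ^ 2 -> (c + ta2 * f) ^ 2 = (g + ta2 * h) ^ 2 ->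
  (g + si3 * c) ^ 2 = (h + si3 * f) ^ 2 -> (p + ta3 * b) ^ 2 = (r + ta3 * e) ^ 2 ->
  (q * g * e = p * f * d /\ b * h * q = c * d * r /\
   r * g * a = s * f * b /\ a * h * p = c * e * s) /\
  (zero_sum4 c f h g /\ zero_sum4 b p r e /\ zero_sum4 s q a d) /\
  (all_symmetric a b c d e f g h p q r s \/
   B a b c h r s 1 1 1 * B a b c h r s 1 (-1) (-1) *
   B a b c h r s (-1) 1 (-1) * B a b c h r s (-1) (-1) 1 = 0).
Proof.
  intros T1 T2 T3 T4 S1 S1' S2 S2' S3 S3' SS C1 C6 C3 C5 C2 C4 D6 D3 D2
    X1 Y1 X2 Y2 X3 Y3.
  assert (Pos : (0 < a /\ 0 < b /\ 0 < c) /\ (0 < d /\ 0 < e /\ 0 < f) /\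
    (0 < g /\ 0 < h /\ 0 < p) /\ (0 < q /\ 0 < r /\ 0 < s))
    by (unfold triangle in *; lra).
  destruct Pos as ((pa & pb & pc) & (pd & pe & pf) & (pg & ph & pp) & (pq & pr & ps)).
  assert (R : q * g * e = p * f * d /\ b * h * q = c * d * r /\
   r * g * a = s * f * b /\ a * h * p = c * e * s).
  { pose proof (heron_of_cosine_eq _ _ _ _ _ _ _ pr ps pp pq (is_sign_mult _ _ S1 S1') C1) as H1.
    pose proof (heron_of_cosine_eq _ _ _ _ _ _ _ pd pb pa pe (is_sign_mult _ _ S1 S1') C6) as H6.
    pose proof (heron_of_cosine_eq _ _ _ _ _ _ _ pf pa pc pq (is_sign_mult _ _ S2 S2') C3) as H3.
    pose proof (heron_of_cosine_eq _ _ _ _ _ _ _ ps ph pd pg (is_sign_mult _ _ S2 S2') C5) as H5.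
    pose proof (heron_of_cosine_eq _ _ _ _ _ _ _ pb pg pp pc (is_sign_mult _ _ S3 S3') C2) as H2.
    pose proof (heron_of_cosine_eq _ _ _ _ _ _ _ pf pe ph pr (is_sign_mult _ _ S3 S3') C4) as H4.
    clear - T1 T2 T3 T4 H1 H2 H3 H4 H5 H6.
    (* Each relation uses three of the faces [v1 v2 v3], [v1 v4 v5], [v6 v5 v2], [v6 v3 v4], any two
       of which share a single vertex. *)
    repeat split.
    - assert (q * e * g = p * f * d); [| lra].
      apply (opposite_faces_relation c q p f a e g d b);
        unfold triangle, heron in *; lra.
    - assert (q * h * b = c * r * d); [| lra].
      apply (opposite_faces_relation p q c r s h b d g);
        unfold triangle, heron in *; lra.
    - assert (r * a * g = s * f * b); [| lra].
      apply (opposite_faces_relation h r s f e a g b d);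
        unfold triangle, heron in *; lra.
    - assert (p * h * a = c * s * e); [| lra].
      apply (opposite_faces_relation q p c s r h a e f);
        unfold triangle, heron in *; lra. }
  split; [exact R |]; destruct R as (R1 & R2 & R3 & R4).
  assert (Z : zero_sum4 c f h g /\ zero_sum4 b p r e /\ zero_sum4 s q a d).
  { split; [| split].
    - apply (zero_sum4_of_sqr c f h g si3); try assumption.
      destruct S3 as [-> | ->]; lra.
    - apply (zero_sum4_of_sqr b p r e si1); assumption.
    - apply (zero_sum4_of_sqr s q a d si2); try assumption.
      destruct S2 as [-> | ->]; lra. }
  split; [exact Z |]; destruct Z as (Z1 & Z2 & Z3).
  assert (N : forall x y, is_sign x -> is_sign y -> x * y = -1 -> y = - x)
    by (intros x y [-> | ->] [-> | ->]; lra).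
  (* The negative product leaves one sign -1 or all three; the sums of cosines exclude the
     latter. *)
  pose proof (is_sign_mult _ _ S1 S1') as [U1 | U1];
  pose proof (is_sign_mult _ _ S2 S2') as [U2 | U2];
  pose proof (is_sign_mult _ _ S3 S3') as [U3 | U3];
  rewrite U1, U2, U3 in *; try (exfalso; lra).
  - apply N in U3; try assumption; subst ta3; clear - C4 D2 X3 Y3 S3 R1 R2 R3 R4 Z1 Z2 Z3 pa pb pc pd pe pf pg ph pp pq pr ps.
    (* The lengths are relabelled by [v6 -> v2 -> v3 -> v6] and [v1 -> v4 -> v5 -> v1]; the next
       case uses the inverse rotation. *)
    destruct (symmetric_or_B_product_zero_supplementary b c a p g d q s f e h r si3) as [(A1 & A2 & A3) | BB];
      try assumption; try (unfold zero_sum4 in *; lra).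
    + destruct S3 as [-> | ->]; lra.
    + destruct S3 as [-> | ->]; lra.
    + apply cosine_eq_cross in C4; try assumption; lra.
    + apply cosine_eq_cross in D2; try assumption; lra.
    + left; split; [| split]; auto using symmetric4_half_turn.
    + right; rewrite <- BB; unfold B; ring.
  - apply N in U2; try assumption; subst ta2; clear - C5 D3 X2 Y2 S2 R1 R2 R3 R4 Z1 Z2 Z3 pa pb pc pd pe pf pg ph pp pq pr ps.
    destruct (symmetric_or_B_product_zero_supplementary c a b f q p e r d g s h si2) as [(A1 & A2 & A3) | BB];
      try assumption; try (unfold zero_sum4 in *; lra).
    + apply cosine_eq_cross in C5; try assumption; lra.
    + apply cosine_eq_cross in D3; try assumption; lra.
    + left; split; [| split]; auto using symmetric4_half_turn.
    + right; rewrite <- BB; unfold B; ring.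
  - apply N in U1; try assumption; subst ta1; clear - C1 D6 X1 Y1 S1 R1 R2 R3 R4 Z1 Z2 Z3 pa pb pc pd pe pf pg ph pp pq pr ps.
    apply (symmetric_or_B_product_zero_supplementary a b c d e f g h p q r s si1); try assumption.
    + lra.
    + apply cosine_eq_cross in C1; try assumption; lra.
    + apply cosine_eq_cross in D6; try assumption; lra.
  - exfalso; apply (cosine_sum_four_faces a b c d e f g h p q r s); assumption.
Qed.

(** The interval is shrunk once per equator. The three constants have negative product by
    [hyperbola_triangle_sign], and each has the sign of its [si * ta]. *)
Lemma equator_flexes_exist l :
  metric_complex l -> realizable_as_nontrivially_flexible l ->
  (forall E, class_III l E) ->
  exists P u v si1 ta1 k1 si2 ta2 k2 si3 ta3 k3,
    equator_flex l P v1 v2 v3 u v si1 ta1 k1 /\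
    equator_flex l P v3 v6 v2 u v si2 ta2 k2 /\
    equator_flex l P v2 v5 v1 u v si3 ta3 k3 /\
    (si1 * ta1) * (si2 * ta2) * (si3 * ta3) < 0.
Proof.
  intros M HF C.
  destruct (flex_on_of_realizable l HF) as (P & u0 & v0 & Fl0).
  destruct (proj1 (class_III_iff l E2345 M) (C E2345)) as [A1 A2].
  destruct (proj1 (class_III_iff l E6214 M) (C E6214)) as [B1 B2].
  destruct (proj1 (class_III_iff l E5136 M) (C E5136)) as [C1 C2].
  assert (FA : frame v1 v2 v3) by (repeat split; discriminate).
  assert (FB : frame v3 v6 v2) by (repeat split; discriminate).
  assert (FC : frame v2 v5 v1) by (repeat split; discriminate).
  destruct (equator_flex_exists l P u0 v0 _ _ _ M Fl0 FA A1 A2)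
    as (u1 & w1 & si1 & ta1 & k1 & I1 & G1).
  pose proof (flex_on_sub _ _ _ _ _ _ I1 Fl0) as Fl1.
  destruct (equator_flex_exists l P u1 w1 _ _ _ M Fl1 FB B1 B2)
    as (u2 & w2 & si2 & ta2 & k2 & I2 & G2).
  pose proof (flex_on_sub _ _ _ _ _ _ I2 Fl1) as Fl2.
  destruct (equator_flex_exists l P u2 w2 _ _ _ M Fl2 FC C1 C2)
    as (u3 & w3 & si3 & ta3 & k3 & I3 & G3).
  pose proof (flex_on_sub _ _ _ _ _ _ I3 Fl2) as (Huv & _ & FF).
  apply (equator_flex_sub _ _ _ _ _ _ _ _ _ _ _ _ I2),
    (equator_flex_sub _ _ _ _ _ _ _ _ _ _ _ _ I3) in G1.
  apply (equator_flex_sub _ _ _ _ _ _ _ _ _ _ _ _ I3) in G2.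
  exists P, u3, w3, si1, ta1, k1, si2, ta2, k2, si3, ta3, k3.
  split; [exact G1 | split; [exact G2 | split; [exact G3 |]]].
  pose proof (ef_hyp _ _ _ _ _ _ _ _ _ _ G1) as H1.
  pose proof (hyperbola_sym _ _ _ _ _ _ _ (ef_hyp _ _ _ _ _ _ _ _ _ _ G2)) as H2.
  pose proof (hyperbola_opposite_l P v5 _ _ _ _ _ _ (hyperbola_opposite_r P v1 _ _ _ _ _ _
    (ef_hyp _ _ _ _ _ _ _ _ _ _ G3))) as H3.
  pose proof (hyperbola_triangle_sign _ _ _ _ _ _ _ _ _ _ _ _ _ _
    Huv (FF v2) (FF v3) (FF v6) H1 H2 H3) as K.
  pose proof (is_sign_mult _ _ (ef_si _ _ _ _ _ _ _ _ _ _ G1) (ef_ta _ _ _ _ _ _ _ _ _ _ G1)) as S1.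
  pose proof (is_sign_mult _ _ (ef_si _ _ _ _ _ _ _ _ _ _ G2) (ef_ta _ _ _ _ _ _ _ _ _ _ G2)) as S2.
  pose proof (is_sign_mult _ _ (ef_si _ _ _ _ _ _ _ _ _ _ G3) (ef_ta _ _ _ _ _ _ _ _ _ _ G3)) as S3.
  pose proof (ef_k _ _ _ _ _ _ _ _ _ _ G1) as K1.
  pose proof (ef_k _ _ _ _ _ _ _ _ _ _ G2) as K2.
  pose proof (ef_k _ _ _ _ _ _ _ _ _ _ G3) as K3.
  pose proof (Rmult_lt_0_compat _ _ (Rmult_lt_0_compat _ _ K1 K2) K3) as KK.
  clear - K S1 S2 S3 KK.
  revert KK; replace (si1 * ta1 * k1 * (si2 * ta2 * k2) * (si3 * ta3 * k3))
    with ((si1 * ta1) * (si2 * ta2) * (si3 * ta3) * (k1 * k3 * k2)) by ring.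
  destruct S1 as [-> | ->], S2 as [-> | ->], S3 as [-> | ->]; lra.
Qed.

(** Brings every length to the orientation in which the theorem names it. *)
Ltac orient_edges S H :=
  rewrite ?(S v2 v1), ?(S v3 v1), ?(S v4 v1), ?(S v5 v1), ?(S v3 v2), ?(S v4 v3),
    ?(S v5 v4), ?(S v2 v5), ?(S v2 v6), ?(S v3 v6), ?(S v4 v6), ?(S v5 v6)
    in H by discriminate.

Theorem mainTheorem5 (l : vertex -> vertex -> R) (E1 E2 E3 : equator)
    (hK : metric_complex l)
    (hflex : realizable_as_nontrivially_flexible l)
    (h12 : E1 <> E2) (h13 : E1 <> E3) (h23 : E2 <> E3)
    (hE1 : class_III l E1) (hE2 : class_III l E2) :
  let p := l v1 v2 in let q := l v1 v3 in
  let r := l v1 v4 in let s := l v1 v5 in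
  let c := l v2 v3 in let f := l v3 v4 in
  let h := l v4 v5 in let g := l v5 v2 in
  let b := l v6 v2 in let a := l v6 v3 in
  let e := l v6 v4 in let d := l v6 v5 in
  (forall E : equator, metrically_symmetric l E) \/
  (class_III l E3 /\
   (q * g * e = p * f * d /\ b * h * q = c * d * r /\
    r * g * a = s * f * b /\ a * h * p = c * e * s) /\
   (forall E : equator, zero_sum l E) /\
   B a b c h r s 1 1 1 * B a b c h r s 1 (-1) (-1) *
   B a b c h r s (-1) 1 (-1) * B a b c h r s (-1) (-1) 1 = 0).
Proof.
  assert (C : forall E, class_III l E).
  { apply class_III_of_two; try assumption.
    destruct E1, E2; tauto. }
  destruct (equator_flexes_exist l hK hflex C)
    as (P & u & v & si1 & ta1 & k1 & si2 & ta2 & k2 & si3 & ta3 & k3 & G1 & G2 & G3 & SS).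
  (* At each vertex one angle relation joins two of the faces [v1 v2 v3], [v1 v4 v5], [v6 v5 v2],
     [v6 v3 v4]; of the others, those at [v6], [v3] and [v2] are also used. *)
  destruct G1 as [S1 S1' _ [C1 D1] [C6' C6] X1 Y1 _].
  destruct G2 as [S2 S2' _ [D3 C3] [C5' D5] X2 Y2 _].
  destruct G3 as [S3 S3' _ [D2 C2] [C4' D4] X3 Y3 _].
  cbn [opposite] in *.
  assert (Sd : forall u w, u <> w -> opposite u <> w -> l u w = l w u)
    by (intros u' w' U W; apply (length_sym l hK); split; assumption).
  assert (Tr : forall x y z, In (x, y, z) faces -> edge x y -> edge y z -> edge z x ->
    triangle (l x y) (l x z) (l y z)).
  { intros x y z F F1 F2 F3; pose proof (strict_triangle l hK x y z F).
    pose proof (length_pos l hK _ _ F1); pose proof (length_pos l hK _ _ F2);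
      pose proof (length_pos l hK _ _ F3).
    rewrite (length_sym l hK x z) by (now apply edge_sym); unfold triangle; lra. }
  pose proof (Tr v1 v2 v3 ltac:(simpl; tauto) ltac:(now split) ltac:(now split) ltac:(now split)) as T1.
  pose proof (Tr v1 v4 v5 ltac:(simpl; tauto) ltac:(now split) ltac:(now split) ltac:(now split)) as T2.
  pose proof (Tr v6 v5 v2 ltac:(simpl; tauto) ltac:(now split) ltac:(now split) ltac:(now split)) as T3.
  pose proof (Tr v6 v3 v4 ltac:(simpl; tauto) ltac:(now split) ltac:(now split) ltac:(now split)) as T4.
  orient_edges Sd D3. orient_edges Sd C3. orient_edges Sd C5'.
  orient_edges Sd D2. orient_edges Sd C2. orient_edges Sd C4'.
  orient_edges Sd X2. orient_edges Sd Y2. orient_edges Sd X3. orient_edges Sd Y3.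
  assert (T3' : triangle (l v6 v5) (l v5 v2) (l v6 v2))
    by (unfold triangle in *; lra).
  destruct (symmetric_or_B_product_zero _ _ _ _ _ _ _ _ _ _ _ _
    si1 ta1 si2 ta2 si3 ta3 T1 T2 T3' T4 S1 S1' S2 S2' S3 S3' SS
    C1 C6 C3 C5' C2 C4' C6' D3 D2 X1 Y1 X2 Y2 X3 Y3)
    as (R & (Z1 & Z2 & Z3) & [(A1 & A2 & A3) | BB]).
  - left; intros []; unfold metrically_symmetric; cbn [cycle].
    + exact A1.
    + rewrite (Sd v2 v1), (Sd v4 v6) by discriminate; exact A2.
    + rewrite (Sd v5 v1), (Sd v3 v6) by discriminate; exact A3.
  - right; split; [exact (C E3) | split; [exact R | split; [| exact BB]]].
    intros []; unfold zero_sum; cbn [cycle].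
    + exact Z1.
    + rewrite (Sd v2 v1), (Sd v4 v6) by discriminate; exact Z2.
    + rewrite (Sd v5 v1), (Sd v3 v6) by discriminate; exact Z3.
Qed.
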